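(* Suppose each $f_i$ is $v_i$-strongly convex with $\ell_i$-Lipschitz gradient, and $\mathcal G$ is undirected and connected with $\mathbf L_{\mathsf u}$ positive definite. Let $\mathcal C$ be a $\delta$-contractive compressor and run CC-DQM with $\mu_k=0$ for all $k$. Suppose that $c>0$, $\delta\in[0,1)$ and a real number $\beta>\frac{\ell^2}{2c\lambda_2 v}$ satisfy $G(\beta)>0$ and $$\frac{\delta}{(1-\sqrt{\delta})^2}<\frac{G(\beta)}{3c\lambda_n+2c\beta\lambda_n+\frac{c\lambda_n^2}{\beta\lambda_2}},$$ where $$G(\beta)=\frac{c\hat\lambda_1}{2}-\frac{2c\beta\lambda_2\ell^2}{2c\beta\lambda_2 v-\ell^2}-\frac{c^2\hat\lambda_n^2+4\ell^2}{c\beta\lambda_2}.$$ Then the sequence $\mathbb E(\tilde{\mathbf x}_k)$ converges linearly to the optimal solution: there is $\sigma\in(0,1)$ such that $\|\mathbb E(\tilde{\mathbf x}_k)-\tilde{\mathbf x}^*\|=\mathcal O(\sigma^k)$ as $k\to\infty$.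
   Context: **Problem.** $n$ agents solve $\min_{\mathbf x\in\mathbb R^d}\sum_{i=1}^n f_i(\mathbf x)$, with $f_i:\mathbb R^d\to\mathbb R$ twice differentiable. The function $f_i$ is $v_i$-strongly convex ($v_i>0$) if $\langle\nabla f_i(x')-\nabla f_i(x),x'-x\rangle\ge v_i\|x'-x\|^2$ for all $x,x'$, and its gradient is $\ell_i$-Lipschitz if $\|\nabla f_i(x')-\nabla f_i(x)\|\le\ell_i\|x'-x\|$ for all $x,x'$. Set $v=\min_i v_i$, $\ell=\max_i\ell_i$. $\mathbf x^*$ denotes the (unique) minimizer of the problem, and $\tilde{\mathbf x}^*=[\mathbf x^*,\dots,\mathbf x^*]\in\mathbb R^{nd}$ is the stack of $n$ copies of it. $\|\cdot\|$ is the Euclidean norm. **Graph.** $\mathcal G=(\mathcal V,\mathcal E)$, $\mathcal V=\{1,\dots,n\}$, $\mathcal E\subset\mathcal V\times\mathcal V$, without self-loops; $\mathcal N_i=\{j:(j,i)\in\mathcal E\}$, $d_i=|\mathcal N_i|$, $\mathbf D=\mathrm{diag}(d_1,\dots,d_n)$, $\mathbf W$ is the adjacency matrix ($w_{ij}=1$ if $(j,i)\in\mathcal E$, else $0$). $\mathbf L=\mathbf D-\mathbf W$ has eigenvalues $\lambda_1\le\dots\le\lambda_n$ and $\mathbf L_{\mathsf u}=\mathbf D+\mathbf W$ has eigenvalues $\hat\lambda_1\le\dots\le\hat\lambda_n$. **Compressor.** A (possibly randomized) map $\mathcal C:\mathbb R^d\to\mathbb R^d$ is a $\delta$-contractive compressor,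 $0\le\delta<1$, if $\mathbb E\|\mathbf x-\mathcal C(\mathbf x)\|^2\le\delta\|\mathbf x\|^2$ for all $\mathbf x\in\mathbb R^d$. Each call of $\mathcal C$ uses fresh randomness independent of the past; $\mathbb E$ is expectation over this randomness. **Algorithm CC-DQM.** Parameters: penalty $c>0$, thresholds $\mu_k\ge0$. Initialize with arbitrary $\mathbf x_{i,0}\in\mathbb R^d$, $\boldsymbol\phi_{i,0}=\mathbf 0$, $\mathbf y_{i,0}=\mathbf 0$. For $k=0,1,2,\dots$, every agent $i$ computes $$\mathbf x_{i,k+1}=\mathbf x_{i,k}-\big(2cd_i\mathbf I+\nabla^2 f_i(\mathbf y_{i,k})\big)^{-1}\Big(\nabla f_i(\mathbf x_{i,k})+c\sum_{j\in\mathcal N_i}(\mathbf y_{i,k}-\mathbf y_{j,k})+\boldsymbol\phi_{i,k}\Big);$$ if $\|\mathbf x_{i,k+1}-\mathbf y_{i,k}\|\ge\mu_k$ then $\mathbf y_{i,k+1}=\mathbf y_{i,k}+\mathcal C(\mathbf x_{i,k+1}-\mathbf y_{i,k})$ (the same realization of $\mathcal C$ is sent to the neighbors), otherwise $\mathbf y_{i,k+1}=\mathbf y_{i,k}$; finally $$\boldsymbol\phi_{i,k+1}=\boldsymbol\phi_{i,k}+c\sum_{j\in\mathcal N_i}(\mathbf y_{i,k+1}-\mathbf y_{j,k+1}).$$ $\tilde{\mathbf x}_k=[\mathbf x_{1,k},\dots,\mathbf x_{n,k}]\in\mathbb R^{nd}$ is the stacked iterate. *)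

(* Defs.v *)
From HB Require Import structures.
From mathcomp Require Export all_boot all_order all_algebra.
From mathcomp Require Export all_classical all_reals all_analysis.
Export Order.TTheory GRing.Theory Num.Theory.
Export numFieldNormedType.Exports.

Set Implicit Arguments.
Unset Strict Implicit.
Unset Printing Implicit Defensive.

Local Open Scope classical_set_scope.
Local Open Scope ring_scope.

Definition dotp (R : realType) (m : nat) (x y : 'cV[R]_m) : R :=
  \sum_(a < m) x a 0 * y a 0.

(* The library norm on matrices is the sup norm, hence this one. *)
Definition enorm (R : realType) (m : nat) (x : 'cV[R]_m) : R :=
  Num.sqrt (dotp x x).

Definition grad (R : realType) (d : nat) (f : 'cV[R]_d -> R) (x : 'cV[R]_d) :
    'cV[R]_d :=
  \col_a 'D_(delta_mx a 0) f x.

Definition hess (R : realType) (d : nat) (f : 'cV[R]_d -> R) (x : 'cV[R]_d) :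
    'M[R]_d :=
  \matrix_(a, b) 'D_(delta_mx b 0) (fun z => grad f z a 0) x.

Definition twice_differentiable (R : realType) (d : nat) (f : 'cV[R]_d -> R) :=
  (forall x, differentiable f x) /\ (forall x, differentiable (grad f) x).

Definition strongly_convex (R : realType) (d : nat) (v : R)
    (f : 'cV[R]_d -> R) :=
  0 < v /\
  forall x x', dotp (grad f x' - grad f x) (x' - x) >= v * enorm (x' - x) ^+ 2.

Definition lipschitz_grad (R : realType) (d : nat) (l : R)
    (f : 'cV[R]_d -> R) :=
  forall x x', enorm (grad f x' - grad f x) <= l * enorm (x' - x).

(* [e j i] stands for the edge (j, i), i.e. j is a neighbor of i. *)
Definition degree (n : nat) (e : rel 'I_n) (i : 'I_n) : nat :=
  #|[set j : 'I_n | e j i]|.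

Definition degree_mx (R : realType) (n : nat) (e : rel 'I_n) : 'M[R]_n :=
  diag_mx (\row_i (degree e i)%:R).

Definition adjacency_mx (R : realType) (n : nat) (e : rel 'I_n) : 'M[R]_n :=
  \matrix_(i, j) (e j i)%:R.

Definition laplacian (R : realType) (n : nat) (e : rel 'I_n) : 'M[R]_n :=
  degree_mx R e - adjacency_mx R e.

Definition signless_laplacian (R : realType) (n : nat) (e : rel 'I_n) :
    'M[R]_n :=
  degree_mx R e + adjacency_mx R e.

Definition posdef (R : realType) (n : nat) (A : 'M[R]_n) :=
  A^T = A /\ forall x : 'cV[R]_n, x != 0 -> 0 < dotp x (A *m x).

(* [s] lists all eigenvalues of [A], with multiplicity, in increasing order;
   the k-th smallest one is [s`_(k.-1)]. *)
Definition ordered_eigenvalues (R : realType) (n : nat) (A : 'M[R]_n)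
    (s : seq R) :=
  sorted <=%R s /\ char_poly A = \prod_(a <- s) ('X - a%:P).

(* A randomized map is a function [C] of the input and of a random seed drawn
   from the probability space (Xi, Q). Joint measurability is with respect to
   the product of the Borel sigma-algebra of R^d and that of Xi; it is what
   makes the iterates below random variables. *)
Definition randomized_map (R : realType) (d : nat) (dX : measure_display)
    (Xi : measurableType dX) (C : 'cV[R]_d -> Xi -> 'cV[R]_d) :=
  forall a : 'I_d, measurable_fun setT
    (fun p : g_sigma_algebraType (@open 'cV[R]_d) * Xi =>
       (C p.1 p.2 a 0 : R)).

Definition contractive_compressor (R : realType) (d : nat)
    (dX : measure_display) (Xi : measurableType dX) (Q : probability Xi R)
    (delta : R) (C : 'cV[R]_d -> Xi -> 'cV[R]_d) :=
  [/\ randomized_map C, 0 <= delta < 1 &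
      forall x, ('E_Q[fun s => (enorm (x - C x s) ^+ 2)%R]
                 <= (delta * enorm x ^+ 2)%:E)%E].

(* Generators of the sigma-algebra of the seeds drawn before iteration k. *)
Definition past_events (n : nat) (dO dX : measure_display)
    (Omega : measurableType dO) (Xi : measurableType dX)
    (seed : nat -> 'I_n -> Omega -> Xi) (k : nat) : set (set Omega) :=
  [set A | exists l j B, [/\ (l < k)%N, measurable B & A = seed l j @^-1` B]].

(* Seeds of different agents at the same iteration may be dependent. *)
Definition fresh_seeds (R : realType) (n : nat) (dO dX : measure_display)
    (Omega : measurableType dO) (Xi : measurableType dX)
    (P : probability Omega R) (Q : probability Xi R)
    (seed : nat -> 'I_n -> {RV P >-> Xi}) :=
  (forall k i A, measurable A -> distribution P (seed k i) A = Q A) /\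
  (forall k i A F, measurable A ->
     <<s past_events (fun l j => seed l j : Omega -> Xi) k >> F ->
     P (seed k i @^-1` A `&` F) = (P (seed k i @^-1` A) * P F)%E).

Record ccdqm_state (R : realType) (n d : nat) := CCDQMState {
  st_x : 'I_n -> 'cV[R]_d;
  st_y : 'I_n -> 'cV[R]_d;
  st_phi : 'I_n -> 'cV[R]_d }.

Definition neighbor_diff (R : realType) (n d : nat) (e : rel 'I_n)
    (y : 'I_n -> 'cV[R]_d) (i : 'I_n) : 'cV[R]_d :=
  \sum_(j < n | e j i) (y i - y j).

(* [Ck i] is the realization of the compressor used by agent i. *)
Definition ccdqm_step (R : realType) (n d : nat) (e : rel 'I_n)
    (f : 'I_n -> 'cV[R]_d -> R) (c muk : R)
    (Ck : 'I_n -> 'cV[R]_d -> 'cV[R]_d) (s : ccdqm_state R n d) :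
    ccdqm_state R n d :=
  let x := st_x s in
  let y := st_y s in
  let phi := st_phi s in
  let x' := fun i => x i -
    invmx ((2 * c * (degree e i)%:R)%:M + hess (f i) (y i)) *m
      (grad (f i) (x i) + c *: neighbor_diff e y i + phi i) in
  let y' := fun i =>
    if muk <= enorm (x' i - y i) then y i + Ck i (x' i - y i) else y i in
  let phi' := fun i => phi i + c *: neighbor_diff e y' i in
  CCDQMState x' y' phi'.

Fixpoint ccdqm (R : realType) (n d : nat) (e : rel 'I_n)
    (f : 'I_n -> 'cV[R]_d -> R) (c : R) (mu : nat -> R)
    (Cs : nat -> 'I_n -> 'cV[R]_d -> 'cV[R]_d) (x0 : 'I_n -> 'cV[R]_d)
    (k : nat) : ccdqm_state R n d :=
  if k is k'.+1 then
    ccdqm_step e f c (mu k') (Cs k') (ccdqm e f c mu Cs x0 k')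
  else CCDQMState x0 (fun _ => 0) (fun _ => 0).

Definition stack (R : realType) (n d : nat) (x : 'I_n -> 'cV[R]_d) :
    'cV[R]_(\sum_(i < n) d) :=
  \mxcol_(i < n) x i.

Definition ccdqm_iterate (R : realType) (n d : nat) (e : rel 'I_n)
    (f : 'I_n -> 'cV[R]_d -> R) (c : R) (mu : nat -> R)
    (dO dX : measure_display) (Omega : measurableType dO)
    (Xi : measurableType dX) (C : 'cV[R]_d -> Xi -> 'cV[R]_d)
    (seed : nat -> 'I_n -> Omega -> Xi) (x0 : 'I_n -> 'cV[R]_d)
    (k : nat) (w : Omega) : 'cV[R]_(\sum_(i < n) d) :=
  stack (st_x (ccdqm e f c mu (fun l i z => C z (seed l i w)) x0 k)).

Definition integrable_vec (R : realType) (m : nat) (dO : measure_display)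
    (Omega : measurableType dO) (P : probability Omega R)
    (X : Omega -> 'cV[R]_m) :=
  forall a, P.-integrable setT (fun w => (X w a 0)%:E).

(* Meaningful under [integrable_vec P X]. *)
Definition expectation_vec (R : realType) (m : nat) (dO : measure_display)
    (Omega : measurableType dO) (P : probability Omega R)
    (X : Omega -> 'cV[R]_m) : 'cV[R]_m :=
  \col_a fine 'E_P[fun w => X w a 0].

Definition rate_gap (R : realType) (c l v lam2 lamu1 lamun beta : R) : R :=
  c * lamu1 / 2
  - 2 * c * beta * lam2 * l ^+ 2 / (2 * c * beta * lam2 * v - l ^+ 2)
  - (c ^+ 2 * lamun ^+ 2 + 4 * l ^+ 2) / (c * beta * lam2).

(* Main.v *)
From HB Require Import structures.
Require Import Defs.
From mathcomp Require Import measurable_realfun.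
From mathcomp Require Import ring lra.

(** The iterates are stored as matrices whose row i belongs to agent i, so that
    the graph acts by left multiplication with the Laplacian L and the signless
    Laplacian Lu, and L + Lu = 2 D.

    Since phi starts at 0 and grows by c L y at each iteration, phi_k = c L s_k
    with s_k the sum of the y_j received so far, and the optimality condition
    (the gradients at the minimizer sum to 0) lets one write the optimal phi as
    c L s* ([laplacian_range]).  Put x = x_k - x*, u = s_k - s*, e = y_k - x_k
    and r = x_(k+1) - x_k.  Then an iteration implies ([ccdqm_relation])
<<
      A + c Lu r + xi + c L (e_k - e_(k+1)) + c L u_(k+1) = 0,
      L (u_(k+1) - u_k) = L (x_(k+1) + e_(k+1)),
>>
    where A is a gradient difference between x_(k+1) and x*, and xi is the error of
    the Hessian model, with norm at most 2 l |r|.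

    The Lyapunov function is the energy (c/2) (<x, Lu x> + <u, L u> + <e, L e>).
    Pairing the first relation with x_(k+1), everything telescopes except the
    good terms - (c/2) <r, Lu r> and - v |x|^2, and the cross terms - <xi, x> and
    c <u, L e> ([energy_descent]).  The cross terms are split by Young's
    inequality; <u, L u> is then bounded by the spectral gap and the first
    relation itself, which expresses c L u through A, r, xi and e ([dual_bound]).
    The outcome ([energy_decrease]) is a decrease by G(beta) |r|^2 and a positive
    multiple of |x|^2, at the price of a multiple of |e_k|^2 and one of
    |e_(k+1)|^2.  The two multiples add up to the denominator of the hypothesis
    on delta.

    The compression error obeys E |e_(k+1)|^2 <= delta E |r - e_k|^2, because the
    seed of iteration k is independent of the past ([fresh_compression]), hence is
    at most sqrt delta E |e_k|^2 + delta / (1 - sqrt delta) E |r|^2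
    ([young_contraction]).  Thus N |e|^2 can be added to the energy, and the
    hypothesis on delta is what makes the resulting |r|^2 term smaller than
    G(beta) |r|^2.  That hypothesis is strict, so a little is left to gain a
    factor 1 + th on the left-hand side ([energy_contraction]).  Taking means
    ([mean_contraction]) gives E |x_k - x*|^2 = O((1 + th)^(-k)), and the norm of
    the mean is at most the root of the mean square ([expectation_vec_dev]).

    Two facts support this: real symmetric matrices whose characteristic
    polynomial splits are orthogonally diagonalizable
    ([symmetric_diagonalization]), and each iterate is measurable with respect to
    the seeds drawn before it ([measurable_iterates]). *)

Set Implicit Arguments.
Unset Strict Implicit.
Unset Printing Implicit Defensive.

Local Open Scope classical_set_scope.
Local Open Scope ring_scope.

(** * Real symmetric matrices are orthogonally diagonalizable *)

(** With K the inverse of H this is the invariance of the characteristic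
    polynomial under similarity. *)
Lemma char_poly_similar (R : comNzRingType) n (A H K : 'M[R]_n) :
  H *m K = 1%:M -> char_poly (H *m A *m K) = char_poly A.
Proof.
move=> HK; have HKp : map_mx polyC H *m map_mx polyC K = 1%:M.
  by rewrite -map_mxM HK map_mx1.
have -> : char_poly (H *m A *m K) =
    \det (map_mx polyC H *m char_poly_mx A *m map_mx polyC K).
  congr (\det _); rewrite /char_poly_mx mulmxBr mulmxBl !map_mxM; congr (_ - _).
  by rewrite mul_mx_scalar -scalemxAl HKp scale_scalar_mx mulr1.
by rewrite !det_mulmx mulrAC -det_mulmx HKp det1 mul1r.
Qed.

Lemma char_poly_block_diag (R : comNzRingType) m n (A : 'M[R]_m) (B : 'M[R]_n) :
  char_poly (block_mx A 0 0 B) = char_poly A * char_poly B.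
Proof. by rewrite /char_poly char_block_diag_mx det_ublock. Qed.

(** H is the reflection exchanging u and the first basis vector; it is used to
    move an eigenvector to the first coordinate without leaving the symmetric
    matrices. *)
Lemma householder (R : rcfType) n (u : 'rV[R]_n.+1) :
  u *m u^T = 1%:M ->
  exists H : 'M[R]_n.+1,
    [/\ H^T = H, H *m H = 1%:M & delta_mx 0 0 *m H = u].
Proof.
move=> uu; pose e0 : 'rV[R]_n.+1 := delta_mx 0 0.
have [w wE] : exists w, w = e0 - u by exists (e0 - u).
have [w0|wn0] := eqVneq w 0.
  exists 1%:M; split; rewrite ?trmx1 ?mulmx1 //.
  by apply/eqP; rewrite -subr_eq0 -/e0 -wE w0.
have e0u : u *m e0^T = (u 0 0)%:M.
  by rewrite [LHS]mx11_scalar /e0 trmx_delta -colE mxE.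
have e0u' : e0 *m u^T = (u 0 0)%:M.
  by rewrite -[LHS]trmxK trmx_mul trmxK e0u tr_scalar_mx.
have e00 : e0 *m e0^T = 1%:M.
  by rewrite [LHS]mx11_scalar trmx_delta mul_delta_mx mxE !eqxx.
have ww : w *m w^T = (2 - 2 * u 0 0)%:M.
  rewrite wE linearB /= mulmxBl !mulmxBr e00 e0u e0u' uu.
  by rewrite -!scalar_mx_is_additive; congr (_%:M); ring.
have wn : 2 - 2 * u 0 0 != 0.
  apply: contra wn0 => /eqP; move: ww => /matrixP/(_ 0 0); rewrite !mxE eqxx mulr1n.
  move=> <- /eqP; rewrite psumr_eq0; last by move=> i _; rewrite !mxE -expr2 sqr_ge0.
  move=> /allP w0; apply/eqP/rowP => i.
  have := w0 i (mem_index_enum _); rewrite !mxE /= -expr2 sqrf_eq0 => /eqP.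
  by [].
pose k := 2 / (2 - 2 * u 0 0).
exists (1%:M - k *: (w^T *m w)); split.
- by rewrite linearB /= trmx1 linearZ /= trmx_mul trmxK.
- rewrite mulmxBl mul1mx mulmxBr mulmx1 -scalemxAl -scalemxAr.
  rewrite mulmxA -(mulmxA w^T) ww mul_mx_scalar -scalemxAl !scalerA.
  have -> : k * (k * (2 - 2 * u 0 0)) = k + k by rewrite /k; field.
  by rewrite scalerDl opprB addrK subrK.
- rewrite -/e0 mulmxBr mulmx1 -scalemxAr mulmxA.
  have -> : e0 *m w^T = (1 - u 0 0)%:M.
    rewrite wE linearB /= mulmxBr e00 e0u'; rewrite -scalar_mx_is_additive //.
  rewrite mul_scalar_mx scalerA.
  have -> : k * (1 - u 0 0) = 1 by rewrite /k; field.
  by rewrite scale1r wE opprB addrC subrK.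
Qed.

(** By induction on the size: a root of the characteristic polynomial has a
    unit eigenvector u, and conjugation by the reflection that sends u to the
    first coordinate leaves, by symmetry, a block-diagonal matrix.  The
    splitting of the polynomial supplies the root and is inherited by the block. *)
Lemma symmetric_diagonalization (R : rcfType) n (A : 'M[R]_n) (s : seq R) :
  A^T = A -> char_poly A = \prod_(a <- s) ('X - a%:P) ->
  exists P : 'M[R]_n,
    P *m P^T = 1%:M /\ A = P^T *m diag_mx (\row_i s`_i) *m P.
Proof.
elim: n A s => [|n IHn] A s As cA.
  by exists 1%:M; split; apply/matrixP => -[].
have ss : size s = n.+1.
  by apply: succn_inj; rewrite -(size_prod_XsubC s id) -cA size_char_poly.
case: s ss cA => [//|a s] /= [ss]; rewrite big_cons => cA.
have /eigenvalueP[v vA v0] : eigenvalue A a.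
  by rewrite eigenvalue_root_char cA rootM root_XsubC eqxx.
pose q := \sum_i v 0 i ^+ 2.
have q0 : 0 < q.
  rewrite lt_def sumr_ge0 ?andbT; last by move=> i _; rewrite sqr_ge0.
  apply: contra v0; rewrite psumr_eq0; last by move=> i _; rewrite sqr_ge0.
  move=> /allP w0; apply/eqP/rowP => i.
  by have := w0 i (mem_index_enum _); rewrite !mxE /= sqrf_eq0 => /eqP.
pose u := (Num.sqrt q)^-1 *: v.
have uu : u *m u^T = 1%:M.
  rewrite /u linearZ /= -scalemxAl -scalemxAr scalerA -expr2 exprVn sqr_sqrtr ?ltW//.
  have -> : v *m v^T = q%:M.
    rewrite [LHS]mx11_scalar; congr (_%:M); rewrite !mxE; apply: eq_bigr => i _.
    by rewrite mxE expr2.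
  by rewrite scale_scalar_mx mulVf ?gt_eqF.
have uA : u *m A = a *: u by rewrite /u -scalemxAl vA scalerA mulrC -scalerA.
have [H [Hs HH e0H]] := householder uu.
have [B BHA] : exists B : 'M[R]_(1 + n), B = H *m A *m H by eexists.
have Bs : B^T = B by rewrite BHA !trmx_mul Hs As mulmxA.
have B0 : row 0 B = a *: delta_mx 0 0.
  by rewrite rowE BHA !mulmxA e0H uA -scalemxAl -e0H -mulmxA HH mulmx1.
have B0j j : B 0 j = (a *+ (j == 0%R))%R.
  move/rowP: B0 => /(_ j); rewrite !mxE => ->.
  by rewrite eqxx /= mulr_natr.
have l0 : lshift n (0 : 'I_1) = 0 :> 'I_n.+1 by apply/val_inj.
have BE : B = block_mx a%:M 0 0 (drsubmx B).
  rewrite -[LHS]submxK; congr block_mx.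
  - by rewrite [LHS]mx11_scalar !mxE; congr (_%:M); rewrite l0 B0j.
  - by apply/matrixP => i j; rewrite !mxE ord1 l0 B0j.
  - by apply/matrixP => i j; rewrite -Bs !mxE ord1 l0 B0j.
have cB : char_poly (drsubmx B) = \prod_(a <- s) ('X - a%:P).
  apply: (@mulfI _ ('X - a%:P)); first by rewrite polyXsubC_eq0.
  rewrite -cA -(char_poly_similar A HH) -BHA [X in _ = char_poly X]BE.
  rewrite (@char_poly_block_diag _ 1 n); congr (_ * _).
  by rewrite /char_poly /char_poly_mx map_scalar_mx /= -scalar_mx_is_additive det_scalar1.
have [|Q [QQ BQ]] := IHn (drsubmx B) s _ cB.
  by rewrite trmx_drsub Bs.
pose K : 'M[R]_(1 + n) := block_mx 1%:M 0 0 Q.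
have KK : K *m K^T = 1%:M.
  rewrite tr_block_mx !trmx0 mulmx_block trmx1 !mulmx0 !mul0mx !addr0 add0r.
  by rewrite mulmx1 QQ -scalar_mx_block.
have BK : B = K^T *m diag_mx (\row_i (a :: s)`_i) *m K.
  have -> : diag_mx (\row_i (a :: s)`_i) =
     block_mx a%:M 0 0 (diag_mx (\row_i s`_i)) :> 'M[R]_(1 + n).
    apply/matrixP => i j; rewrite !mxE.
    case: splitP => i' ei; rewrite !mxE; case: splitP => j' ej; rewrite !mxE.
    - by rewrite !ord1 in ei ej *; rewrite -!val_eqE /= ei ej.
    - by rewrite !ord1 in ei *; rewrite -!val_eqE /= ei ej.
    - by rewrite !ord1 in ej *; rewrite -!val_eqE /= ei ej.
    - by rewrite -!val_eqE /= ei ej.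
  rewrite BE BQ /K tr_block_mx !trmx0 trmx1 !mulmx_block.
  by rewrite !(mulmx0, mul0mx, mulmx1, mul1mx, addr0, add0r).
exists (K *m H); split.
  by rewrite trmx_mul Hs mulmxA -(mulmxA K) HH mulmx1.
have -> : A = H *m B *m H.
  by rewrite BHA !mulmxA HH mul1mx -mulmxA HH mulmx1.
by rewrite BK trmx_mul Hs !mulmxA.
Qed.

(** * Inner product of stacked vectors and graph Laplacians *)

(** The Frobenius inner product, i.e. the Euclidean one on stacked vectors. *)
Definition mdot (R : realType) m d (X Y : 'M[R]_(m, d)) : R := \tr (X^T *m Y).

Lemma mdotE (R : realType) m d (X Y : 'M[R]_(m, d)) :
  mdot X Y = \sum_i \sum_a X i a * Y i a.
Proof.
rewrite exchange_big /mdot /mxtrace; apply: eq_bigr => a _; rewrite mxE.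
by apply: eq_bigr => i _; rewrite mxE.
Qed.

Lemma mdotC (R : realType) m d (X Y : 'M[R]_(m, d)) : mdot X Y = mdot Y X.
Proof. by rewrite /mdot -mxtrace_tr trmx_mul trmxK. Qed.

Lemma mdotDl (R : realType) m d (X Y Z : 'M[R]_(m, d)) :
  mdot (X + Y) Z = mdot X Z + mdot Y Z.
Proof. by rewrite /mdot linearD /= mulmxDl linearD. Qed.

Lemma mdotZl (R : realType) m d (k : R) (X Z : 'M[R]_(m, d)) :
  mdot (k *: X) Z = k * mdot X Z.
Proof. by rewrite /mdot linearZ /= -scalemxAl linearZ. Qed.

Lemma mdotNl (R : realType) m d (X Z : 'M[R]_(m, d)) :
  mdot (- X) Z = - mdot X Z.
Proof. by rewrite -scaleN1r mdotZl mulN1r. Qed.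

Lemma mdotDr (R : realType) m d (X Y Z : 'M[R]_(m, d)) :
  mdot Z (X + Y) = mdot Z X + mdot Z Y.
Proof. by rewrite !(mdotC Z) mdotDl. Qed.

Lemma mdotZr (R : realType) m d (k : R) (X Z : 'M[R]_(m, d)) :
  mdot Z (k *: X) = k * mdot Z X.
Proof. by rewrite !(mdotC Z) mdotZl. Qed.

Lemma mdotNr (R : realType) m d (X Z : 'M[R]_(m, d)) :
  mdot Z (- X) = - mdot Z X.
Proof. by rewrite !(mdotC Z) mdotNl. Qed.

Definition mdot_linear := (mdotDl, mdotDr, mdotNl, mdotNr, mdotZl, mdotZr).

Lemma mdotx0 (R : realType) m d (X : 'M[R]_(m, d)) : mdot X 0 = 0.
Proof. by rewrite /mdot mulmx0 mxtrace0. Qed.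

Lemma mdot_ge0 (R : realType) m d (X : 'M[R]_(m, d)) : 0 <= mdot X X.
Proof.
by rewrite mdotE; do 2![apply: sumr_ge0 => ? _]; rewrite -expr2 sqr_ge0.
Qed.

Lemma mdot_eq0 (R : realType) m d (X : 'M[R]_(m, d)) : mdot X X = 0 -> X = 0.
Proof.
rewrite mdotE => /eqP; rewrite psumr_eq0 => [/allP X0|i _]; last first.
  by apply: sumr_ge0 => a _; rewrite -expr2 sqr_ge0.
apply/matrixP => i a; have := X0 i (mem_index_enum _).
rewrite /= psumr_eq0 => [/allP Xi0|b _]; last by rewrite -expr2 sqr_ge0.
by have := Xi0 a (mem_index_enum _); rewrite /= -expr2 sqrf_eq0 mxE => /eqP.
Qed.

Lemma mdot_mull (R : realType) m d (A : 'M[R]_m) (X Y : 'M[R]_(m, d)) :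
  mdot (A *m X) Y = mdot X (A^T *m Y).
Proof. by rewrite /mdot trmx_mul mulmxA. Qed.

Lemma mdot_sym (R : realType) m d (A : 'M[R]_m) (X Y : 'M[R]_(m, d)) :
  A^T = A -> mdot X (A *m Y) = mdot Y (A *m X).
Proof. by move=> As; rewrite mdotC mdot_mull As. Qed.

(** In an orthonormal eigenbasis the form is a sum of squares weighted by the
    values of the polynomial a + b t + g t^2 at the eigenvalues.  All spectral
    estimates below are instances. *)
Lemma spectral_quadratic_ge0 (R : realType) m d (A : 'M[R]_m) (s : seq R)
    (a b g : R) (X : 'M[R]_(m, d)) :
  A^T = A -> char_poly A = \prod_(a <- s) ('X - a%:P) ->
  (forall i, (i < m)%N -> 0 <= a + b * s`_i + g * s`_i ^+ 2) ->
  0 <= a * mdot X X + b * mdot X (A *m X) + g * mdot (A *m X) (A *m X).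
Proof.
move=> As cA abg; have [P [PP AE]] := symmetric_diagonalization As cA.
have P'P : P^T *m P = 1%:M by apply: mulmx1C.
set D := diag_mx _ in AE.
have Ds : D^T = D by rewrite tr_diag_mx.
pose Z := P *m X.
have -> : mdot X X = mdot Z Z by rewrite mdot_mull mulmxA P'P mul1mx.
have -> : mdot X (A *m X) = mdot Z (D *m Z).
  by rewrite mdot_mull AE !mulmxA.
have -> : mdot (A *m X) (A *m X) = mdot (D *m Z) (D *m Z).
  rewrite !AE -!mulmxA mdot_mull trmxK (mulmxA P) PP mul1mx //.
rewrite !mdotE !mulr_sumr -!big_split /=; apply: sumr_ge0 => i _.
rewrite !mulr_sumr -!big_split /=; apply: sumr_ge0 => j _.
rewrite mul_diag_mx !mxE.
have -> (z t : R) : a * (z * z) + b * (z * (t * z)) + g * (t * z * (t * z)) =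
   (a + b * t + g * t ^+ 2) * z ^+ 2 by ring.
by rewrite mulr_ge0 ?sqr_ge0 // abg.
Qed.

Lemma ordered_eigenvalues_size (R : realType) n (A : 'M[R]_n) (s : seq R) :
  ordered_eigenvalues A s -> size s = n.
Proof.
case=> _ cA; apply: succn_inj.
by rewrite -(size_prod_XsubC s id) -cA size_char_poly.
Qed.

Lemma ordered_eigenvalues_le (R : realType) n (A : 'M[R]_n) (s : seq R) i j :
  ordered_eigenvalues A s -> (i <= j < n)%N -> s`_i <= s`_j.
Proof.
move=> As /andP[ij jn]; have ss := ordered_eigenvalues_size As.
case: As => srt _; apply: (le_sorted_leq_nth 0 srt) => //.
all: by rewrite inE ss ?(leq_ltn_trans ij).
Qed.

Lemma eigenbasis (R : realType) n (A : 'M[R]_n) (s : seq R) :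
  A^T = A -> ordered_eigenvalues A s ->
  exists p : 'I_n -> 'cV[R]_n,
    [/\ forall i j, mdot (p i) (p j) = (i == j)%:R,
        forall i, A *m p i = s`_i *: p i &
        forall v : 'cV[R]_n, v = \sum_i mdot (p i) v *: p i].
Proof.
move=> As [_ cA]; have [P [PP AE]] := symmetric_diagonalization As cA.
have P'P : P^T *m P = 1%:M by apply: mulmx1C.
have pv (v : 'cV[R]_n) i : mdot (col i P^T) v = (P *m v) i 0.
  by rewrite mdotE mxE; apply: eq_bigr => k _; rewrite big_ord1 !mxE.
exists (fun i => col i P^T); split=> [i j|i|v].
- by rewrite pv colE mulmxA PP mul1mx !mxE eqxx andbT.
- rewrite AE colE !mulmxA -(mulmxA _ P) PP mulmx1 -mulmxA.
  rewrite scalemxAr; congr (_ *m _); rewrite -colE.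
  by apply/colP => k; rewrite !mxE !eqxx andbT mulr_natr; case: eqP => [->|].
- rewrite -[LHS]mul1mx -P'P -mulmxA; apply/colP => k; rewrite [LHS]mxE summxE.
  by apply: eq_bigr => i _; rewrite pv [RHS]mxE mulrC; congr (_ * _); rewrite !mxE.
Qed.

Section QuadraticFormBounds.
Variables (R : realType) (n : nat) (A : 'M[R]_n.+1) (s : seq R).
Hypotheses (As : A^T = A) (sP : ordered_eigenvalues A s).

Lemma eigenvalue_first_le d (X : 'M[R]_(n.+1, d)) :
  s`_0 * mdot X X <= mdot X (A *m X).
Proof.
have := @spectral_quadratic_ge0 _ _ d _ s (- s`_0) 1 0 X As (proj2 sP).
rewrite mul0r addr0 mul1r mulNr addrC subr_ge0; apply=> i ni.
by rewrite mul0r addr0 mul1r addrC subr_ge0 (ordered_eigenvalues_le sP).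
Qed.

Lemma le_eigenvalue_last d (X : 'M[R]_(n.+1, d)) :
  mdot X (A *m X) <= s`_n * mdot X X.
Proof.
have := @spectral_quadratic_ge0 _ _ d _ s (s`_n) (-1) 0 X As (proj2 sP).
rewrite mul0r addr0 mulN1r subr_ge0; apply=> i ni.
rewrite mul0r addr0 mulN1r subr_ge0.
by apply: (ordered_eigenvalues_le sP); rewrite -ltnS ni ltnSn.
Qed.

Lemma sqr_le_eigenvalue_last d (X : 'M[R]_(n.+1, d)) : 0 <= s`_0 ->
  mdot (A *m X) (A *m X) <= s`_n ^+ 2 * mdot X X.
Proof.
move=> s0; have s_ge0 i : (i < n.+1)%N -> 0 <= s`_i.
  by move=> ni; rewrite (le_trans s0) // (ordered_eigenvalues_le sP).
have := @spectral_quadratic_ge0 _ _ d _ s (s`_n ^+ 2) 0 (-1) X As (proj2 sP).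
rewrite mul0r addr0 mulN1r subr_ge0; apply=> i ni.
rewrite mul0r addr0 mulN1r subr_ge0 ler_sqr ?nnegrE ?s_ge0//.
by apply: (ordered_eigenvalues_le sP); rewrite -ltnS ni ltnSn.
Qed.

Lemma posdef_eigenvalue_first : posdef A -> 0 < s`_0.
Proof.
move=> [_ Apos]; have [p [pp Ap _]] := eigenbasis As sP.
have pne : p 0 != 0.
  apply/eqP => z; have := pp 0 0; rewrite z eqxx /mdot trmx0 mul0mx mxtrace0.
  by move/esym/eqP; rewrite oner_eq0.
have := Apos _ pne; rewrite Ap /dotp.
have -> : \sum_a p 0 a 0 * (s`_0 *: p 0) a 0 = mdot (p 0) (s`_0 *: p 0).
  by rewrite mdotE; apply: eq_bigr => i _; rewrite big_ord1.
by rewrite mdotZr pp eqxx mulr1.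
Qed.

End QuadraticFormBounds.

Section Laplacian.
Variables (R : realType) (n : nat) (e : rel 'I_n).
Hypothesis e_sym : symmetric e.
Implicit Types d : nat.

Lemma adjacency_mul d (X : 'M[R]_(n, d)) i a :
  (adjacency_mx R e *m X) i a = \sum_(j | e j i) X j a.
Proof.
rewrite mxE [RHS]big_mkcond /=; apply: eq_bigr => j _; rewrite mxE.
by case: (e j i); rewrite ?mul1r ?mul0r.
Qed.

Lemma laplacian_mul d (X : 'M[R]_(n, d)) i a :
  (laplacian R e *m X) i a = \sum_(j | e j i) (X i a - X j a).
Proof.
rewrite /laplacian mulmxBl mxE [X in _ + X]mxE adjacency_mul mul_diag_mx !mxE.
rewrite sumrB; congr (_ - _).
rewrite sumr_const /degree mulr_natl; congr (_ *+ _); apply: eq_card => j.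
  by rewrite unfold_in /= /in_set asboolb.
Qed.

Lemma adjacency_tr : (adjacency_mx R e)^T = adjacency_mx R e.
Proof. by apply/matrixP => i j; rewrite !mxE e_sym. Qed.

Lemma laplacian_tr : (laplacian R e)^T = laplacian R e.
Proof. by rewrite linearB /= tr_diag_mx adjacency_tr. Qed.

Lemma signless_laplacian_tr : (signless_laplacian R e)^T = signless_laplacian R e.
Proof. by rewrite linearD /= tr_diag_mx adjacency_tr. Qed.

Lemma laplacian_signless :
  laplacian R e + signless_laplacian R e = 2 *: degree_mx R e.
Proof.
by rewrite /laplacian /signless_laplacian addrCA subrK scaler_nat mulr2n.
Qed.

(** The Dirichlet form: symmetrize the sum over the edges. *)
Lemma laplacian_dirichlet d (X : 'M[R]_(n, d)) :
  2 * mdot X (laplacian R e *m X) =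
  \sum_i \sum_(j | e j i) \sum_a (X i a - X j a) ^+ 2.
Proof.
have E : mdot X (laplacian R e *m X) =
    \sum_i \sum_(j | e j i) \sum_a X i a * (X i a - X j a).
  rewrite mdotE; apply: eq_bigr => i _; rewrite exchange_big /=.
  by apply: eq_bigr => a _; rewrite laplacian_mul mulr_sumr.
rewrite mulr2n mulrDl mul1r {1}E E.
under [X in _ + X]eq_bigr do rewrite big_mkcond.
rewrite exchange_big /=; under [X in _ + X]eq_bigr do rewrite -big_mkcond /=.
rewrite -big_split; apply: eq_bigr => i _ /=.
under [X in _ + X]eq_bigl do rewrite e_sym.
rewrite -big_split; apply: eq_bigr => j _ /=.
rewrite -big_split; apply: eq_bigr => a _ /=; ring.
Qed.

Lemma laplacian_psd d (X : 'M[R]_(n, d)) : 0 <= mdot X (laplacian R e *m X).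
Proof.
rewrite -(pmulr_rge0 _ (@ltr0n R 2)) laplacian_dirichlet.
by do 3![apply: sumr_ge0 => ? _]; rewrite sqr_ge0.
Qed.

Hypothesis e_conn : forall i j, connect e i j.

(** Each edge contributes a square to the Dirichlet form, so X agrees at the
    ends of each edge, hence along paths. *)
Lemma laplacian_kernel d (X : 'M[R]_(n, d)) :
  mdot X (laplacian R e *m X) = 0 -> forall i j a, X i a = X j a.
Proof.
move=> X0 i j a; have /connectP[p + ->] := e_conn i j.
have step k l : e k l -> X k a = X l a.
  move=> ekl; move: (laplacian_dirichlet X); rewrite X0 mulr0 => /esym/eqP.
  have ge0 i' : 0 <= \sum_(j | e j i') \sum_a (X i' a - X j a) ^+ 2.
    by do 2![apply: sumr_ge0 => ? _]; rewrite sqr_ge0.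
  rewrite psumr_eq0 // => /allP/(_ l (mem_index_enum _)) /=.
  rewrite psumr_eq0 => [/allP/(_ k (mem_index_enum _))|? _]; last first.
    by apply: sumr_ge0 => ? _; rewrite sqr_ge0.
  rewrite ekl /= psumr_eq0 => [/allP/(_ a (mem_index_enum _))|? _]; last first.
    by rewrite sqr_ge0.
  by rewrite /= sqrf_eq0 subr_eq0 => /eqP.
elim: p i => //= k p IHp i /andP[eik /IHp <-]; exact: step.
Qed.

End Laplacian.

Section LaplacianSpectrum.
Variables (R : realType) (n : nat) (e : rel 'I_n.+1) (lam : seq R).
Hypotheses (e_sym : symmetric e) (e_conn : forall i j, connect e i j).
Hypothesis lamP : ordered_eigenvalues (laplacian R e) lam.
Let L := laplacian R e.
Let Ls : L^T = L := laplacian_tr R e_sym.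

Lemma laplacian_const_mul d (X : 'M[R]_(n.+1, d)) :
  (forall i j a, X i a = X j a) -> L *m X = 0.
Proof.
move=> Xc; apply/matrixP => i a; rewrite laplacian_mul mxE.
by rewrite big1 // => j _; rewrite (Xc i j) subrr.
Qed.

Lemma laplacian_eigenvalue_ge0 i : (i < n.+1)%N -> 0 <= lam`_i.
Proof.
move=> ni; have [p [pp Ap _]] := eigenbasis Ls lamP.
have := laplacian_psd e_sym (p (Ordinal ni)); rewrite -/L Ap mdotZr pp eqxx mulr1.
by [].
Qed.

Lemma laplacian_eigenvalue_first : lam`_0 = 0.
Proof.
apply/eqP; rewrite eq_le laplacian_eigenvalue_ge0 // andbT leNgt; apply/negP => l0.
pose X : 'cV[R]_n.+1 := const_mx 1.
have LX : L *m X = 0 by apply: laplacian_const_mul => i j a; rewrite !mxE.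
have := eigenvalue_first_le Ls lamP X.
rewrite LX mdotx0 pmulr_rle0 // => X0.
have /mdot_eq0/colP/(_ 0) : mdot X X = 0 by apply/eqP; rewrite eq_le X0 mdot_ge0.
by rewrite !mxE => /eqP; rewrite oner_eq0.
Qed.

(** A second null eigenvalue would give two orthonormal eigenvectors that are
    both constant along the connected graph. *)
Lemma laplacian_spectral_gap : (0 < n)%N -> 0 < lam`_1.
Proof.
move=> n0; rewrite lt_def laplacian_eigenvalue_ge0 ?ltnS// andbT; apply/negP => /eqP l1.
have [p [pp Ap _]] := eigenbasis Ls lamP.
have n1 : (1 < n.+1)%N by rewrite ltnS.
have pc (i : 'I_n.+1) : lam`_i = 0 -> forall k, p i k 0 = p i 0 0.
  move=> li k; apply: (laplacian_kernel e_sym e_conn).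
  by rewrite -/L Ap li scale0r mdotx0.
have p0 := pc 0 laplacian_eigenvalue_first.
have p1 := pc (Ordinal n1) l1.
have pne (i : 'I_n.+1) : lam`_i = 0 -> p i 0 0 != 0.
  move=> li; apply/eqP => z; have := pp i i; rewrite eqxx mdotE big1.
    by move=> /esym/eqP; rewrite oner_eq0.
  by move=> k _; rewrite big1// => a _; rewrite ord1 pc // z mul0r.
have := pp 0 (Ordinal n1); rewrite mdotE.
under eq_bigr do rewrite big_ord1 p0 p1.
rewrite sumr_const card_ord => /eqP; rewrite /= mulrn_eq0 /= mulf_eq0.
by rewrite (negPf (pne 0 laplacian_eigenvalue_first)) (negPf (pne (Ordinal n1) l1)).
Qed.

(** The weight t (t - lam_2) vanishes at the first eigenvalue, which is 0, and is
    nonnegative at the others, which are at least lam_2 >= 0. *)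
Lemma laplacian_gap d (X : 'M[R]_(n.+1, d)) :
  lam`_1 * mdot X (L *m X) <= mdot (L *m X) (L *m X).
Proof.
have := @spectral_quadratic_ge0 _ _ d _ lam 0 (- lam`_1) 1 X Ls (proj2 lamP).
rewrite mul0r add0r mul1r mulNr addrC subr_ge0; apply=> i ni.
have -> : 0 + - lam`_1 * lam`_i + 1 * lam`_i ^+ 2 = lam`_i * (lam`_i - lam`_1) by ring.
case: i ni => [|i] ni; first by rewrite laplacian_eigenvalue_first mul0r.
rewrite mulr_ge0 ?laplacian_eigenvalue_ge0 // subr_ge0.
exact: (ordered_eigenvalues_le lamP).
Qed.

Lemma laplacian_sqr_le_form d (X : 'M[R]_(n.+1, d)) :
  mdot (L *m X) (L *m X) <= lam`_n * mdot X (L *m X).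
Proof.
have := @spectral_quadratic_ge0 _ _ d _ lam 0 (lam`_n) (-1) X Ls (proj2 lamP).
rewrite mul0r add0r mulN1r subr_ge0; apply=> i ni.
rewrite add0r mulN1r subr_ge0 expr2 ler_wpM2r ?laplacian_eigenvalue_ge0//.
by apply: (ordered_eigenvalues_le lamP); rewrite -ltnS ni ltnSn.
Qed.

(** Expand G in an eigenbasis: the component along the constant eigenvector is
    the column sum of G, and all others can be divided by their eigenvalue. *)
Lemma laplacian_range d (G : 'M[R]_(n.+1, d)) :
  (0 < n)%N -> (forall a, \sum_i G i a = 0) -> exists S, L *m S = G.
Proof.
move=> n0 G0; have [p [pp Ap pv]] := eigenbasis Ls lamP.
exists (\sum_(i < n.+1) (lam`_i)^-1 *: (p i *m ((p i)^T *m G))).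
rewrite linear_sum /=.
rewrite [RHS](_ : G = \sum_i p i *m ((p i)^T *m G)); last first.
  under eq_bigr do rewrite mulmxA.
  rewrite -mulmx_suml -[LHS]mul1mx; congr (_ *m _).
  apply/matrixP => k l; rewrite summxE; have := pv (delta_mx l 0).
  move/colP/(_ k); rewrite !mxE eqxx andbT => ->; rewrite summxE.
  apply: eq_bigr => i _; rewrite !mxE big_ord1 mulrC !mxE; congr (_ * _).
  rewrite mdotE (bigD1 l) //= big_ord1 !mxE !eqxx mulr1 big1 ?addr0 // => j jl.
  by rewrite big_ord1 !mxE (negPf jl) mulr0.
have c0 : (p 0)^T *m G = 0.
  have pc k : p 0 k 0 = p 0 0 0.
    apply: (laplacian_kernel e_sym e_conn).
    by rewrite -/L Ap laplacian_eigenvalue_first scale0r mdotx0.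
  apply/matrixP => i a; rewrite !mxE; under eq_bigr do rewrite mxE.
  rewrite ord1; under eq_bigr do rewrite pc.
  by rewrite -mulr_sumr G0 mulr0.
apply: eq_bigr => i _; have [->|i0] := eqVneq i 0.
  by rewrite c0 mulmx0 scaler0 mulmx0.
rewrite -scalemxAr (mulmxA L) Ap -scalemxAl scalerA mulVf ?scale1r //.
rewrite gt_eqF // (lt_le_trans (laplacian_spectral_gap n0)) //.
by apply: (ordered_eigenvalues_le lamP); rewrite ltn_ord lt0n -val_eqE in i0 *; rewrite i0.
Qed.

End LaplacianSpectrum.

(** * One step decreases an energy, up to compression errors *)

Lemma mdot_sqr_split (R : realType) m d (p q : R) (S T : 'M[R]_(m, d)) :
  0 < p -> 0 < q ->
  mdot (S + T) (S + T) <= (p + q) * (mdot S S / p + mdot T T / q).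
Proof.
move=> p0 q0; have := mdot_ge0 (q *: S - p *: T).
rewrite !mdot_linear (mdotC T S) => H; rewrite -subr_ge0.
have -> : (p + q) * (mdot S S / p + mdot T T / q) -
    (mdot S S + mdot S T + (mdot S T + mdot T T)) =
    (q * (q * mdot S S) - q * (p * mdot S T) +
      (- (p * (q * mdot S T)) - - (p * (p * mdot T T)))) / (p * q).
  by field; rewrite !gt_eqF.
by apply: divr_ge0; [move: H; lra | rewrite mulr_ge0 ?ltW].
Qed.

(** Convexity of the square, with weights left free so that they can be tuned
    to the budget of each summand. *)
Lemma mdot_sqr_sum4 (R : realType) m d (a b g h : R) (S T U V : 'M[R]_(m, d)) :
  0 < a -> 0 < b -> 0 < g -> 0 < h -> a + b + g + h = 1 ->
  mdot (S + T + U + V) (S + T + U + V) <=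
    mdot S S / a + mdot T T / b + mdot U U / g + mdot V V / h.
Proof.
move=> a0 b0 g0 h0 s1.
have ab0 : 0 < a + b by rewrite addr_gt0.
have abg0 : 0 < a + b + g by rewrite addr_gt0.
have H1 := mdot_sqr_split (S + T + U) V abg0 h0; rewrite s1 mul1r in H1.
have H2 := mdot_sqr_split (S + T) U ab0 g0.
have H3 := mdot_sqr_split S T a0 b0.
apply: (le_trans H1); rewrite lerD2r ler_pdivrMr // mulrC.
apply: (le_trans H2); rewrite ler_pM2l // lerD2r ler_pdivrMr // mulrC.
by [].
Qed.

(** The Lyapunov function.  The term in e is what makes the error c L (e_k - e_(k+1))
    telescope. *)
Definition energy (R : realType) n d (c : R) (L Lu : 'M[R]_n)
    (x u e : 'M[R]_(n, d)) : R :=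
  c / 2 * (mdot x (Lu *m x) + mdot u (L *m u) + mdot e (L *m e)).

(** Pair the second relation with x1, and rewrite L x1 as L (u1 - u0 - e1).  The
    error terms that remain are c/2 times a square with w = (e0 - e1) + (u1 - u0),
    up to differences of the energy. *)
Lemma energy_descent (R : realType) n d (c : R) (L Lu : 'M[R]_n)
    (x0 x1 u0 u1 e0 e1 A xi : 'M[R]_(n, d)) :
  0 < c -> L^T = L -> Lu^T = Lu ->
  (forall X : 'M[R]_(n, d), 0 <= mdot X (L *m X)) ->
  L *m (u1 - u0) = L *m (x1 + e1) ->
  A + c *: (Lu *m (x1 - x0)) + xi + c *: (L *m (e0 - e1)) + c *: (L *m u1) = 0 ->
  energy c L Lu x1 u1 e1 <=
    energy c L Lu x0 u0 e0 - c / 2 * mdot (x1 - x0) (Lu *m (x1 - x0))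
    - mdot A x1 - mdot xi x1 + c * mdot u1 (L *m e1).
Proof.
move=> c0 Ls Lus Lpsd H1 H2.
have H2x : mdot (A + c *: (Lu *m (x1 - x0)) + xi + c *: (L *m (e0 - e1)) +
   c *: (L *m u1)) x1 = 0 by rewrite H2 mdotC mdotx0.
have H1Z Z : c * mdot Z (L *m (u1 - u0)) = c * mdot Z (L *m (x1 + e1)) by rewrite H1.
have := H1Z u1; have := H1Z u0; have := H1Z e0; have := H1Z e1.
have : 0 <= c / 2 * mdot (u1 - u0 + (e0 - e1)) (L *m (u1 - u0 + (e0 - e1))).
  by rewrite mulr_ge0 // divr_ge0 // ltW.
move: H2x; rewrite /energy !(mulmxDr, mulmxN, mdot_linear, mdot_mull) ?Ls ?Lus.
have sL := fun X Y : 'M[R]_(n, d) => mdot_sym X Y Ls.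
have sLu := fun X Y : 'M[R]_(n, d) => mdot_sym X Y Lus.
rewrite (sLu x1 x0) (sL u1 u0) (sL e1 e0) (sL u1 e0) (sL u1 e1) (sL u0 e0) (sL u0 e1).
rewrite (sL u1 x1) (sL u0 x1) (sL e1 x1) (sL e0 x1).
lra.
Qed.

Section Descent.
Variables (R : realType) (n d : nat) (L Lu : 'M[R]_n).
Variables (lam2 lamn lamu1 lamun c v l beta : R).
Hypotheses (Ls : L^T = L) (Lus : Lu^T = Lu).
Hypothesis L_psd : forall X : 'M[R]_(n, d), 0 <= mdot X (L *m X).
Hypothesis L_gap : forall X : 'M[R]_(n, d),
  lam2 * mdot X (L *m X) <= mdot (L *m X) (L *m X).
Hypothesis L_le : forall X : 'M[R]_(n, d), mdot X (L *m X) <= lamn * mdot X X.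
Hypothesis L_sqr_le : forall X : 'M[R]_(n, d),
  mdot (L *m X) (L *m X) <= lamn ^+ 2 * mdot X X.
Hypothesis Lu_ge : forall X : 'M[R]_(n, d), lamu1 * mdot X X <= mdot X (Lu *m X).
Hypothesis Lu_le : forall X : 'M[R]_(n, d), mdot X (Lu *m X) <= lamun * mdot X X.
Hypothesis Lu_sqr_le : forall X : 'M[R]_(n, d),
  mdot (Lu *m X) (Lu *m X) <= lamun ^+ 2 * mdot X X.
Hypotheses (lam2_gt0 : 0 < lam2) (lamn_gt0 : 0 < lamn) (lamun_ge0 : 0 <= lamun).
Hypotheses (c_gt0 : 0 < c) (v_gt0 : 0 < v) (l_neq0 : l != 0).
Hypothesis beta_gt : l ^+ 2 / (2 * c * lam2 * v) < beta.

(** What one iteration says about the deviations x from the minimizer, u from the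
    dual optimum, and the compression errors e.  A stands for the change of the
    gradients from the minimizer and xi for the error of the Hessian model. *)
Definition ccdqm_relation (x0 x1 u0 u1 e0 e1 : 'M[R]_(n, d)) : Prop :=
  exists A xi : 'M[R]_(n, d),
  [/\ L *m (u1 - u0) = L *m (x1 + e1),
      A + c *: (Lu *m (x1 - x0)) + xi + c *: (L *m (e0 - e1)) +
        c *: (L *m u1) = 0,
      v * mdot x1 x1 <= mdot A x1,
      mdot A A <= l ^+ 2 * mdot x1 x1 &
      mdot xi xi <= 4 * l ^+ 2 * mdot (x1 - x0) (x1 - x0)].

Let eta := l ^+ 2 / (2 * c * beta * lam2).
Let gam := lamn / (beta * lam2).
Let h := c * lamn * (3 + gam) / 2.
Let zeta := 6 * eta / (9 + gam).
Let G := rate_gap c l v lam2 lamu1 lamun beta.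

Let l2_gt0 : 0 < l ^+ 2. Proof. by rewrite exprn_even_gt0. Qed.

Let beta_gt0 : 0 < beta.
Proof. by apply: le_lt_trans beta_gt; rewrite divr_ge0 ?sqr_ge0 // !mulr_ge0 // ltW. Qed.

Let eta_gt0 : 0 < eta. Proof. by rewrite /eta divr_gt0 // !mulr_gt0. Qed.

Let eta_lt : eta < v.
Proof.
move: beta_gt; rewrite ltr_pdivrMr ?mulr_gt0 // => H.
by rewrite /eta ltr_pdivrMr ?mulr_gt0 //; move: H; lra.
Qed.

Let gam_gt0 : 0 < gam. Proof. by rewrite /gam divr_gt0 // mulr_gt0. Qed.

(** The dual variable is controlled through the spectral gap by c L u1, which
    the relation expresses as a sum of four terms. *)
Lemma dual_bound x0 x1 u0 u1 e0 e1 :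
  ccdqm_relation x0 x1 u0 u1 e0 e1 ->
  c / (8 * beta) * mdot u1 (L *m u1) <=
    eta * (3 + gam) / (9 + gam) * mdot x1 x1 +
    (c ^+ 2 * lamun ^+ 2 + 4 * l ^+ 2) / (c * beta * lam2) *
      mdot (x1 - x0) (x1 - x0) + h * (mdot e0 e0 + mdot e1 e1).
Proof.
move=> [A [xi [H1 H2 H3 H4 H5]]].
set X := mdot x1 x1 in H3 H4 *.
set rho := mdot (x1 - x0) (x1 - x0) in H5 *.
set T := mdot (L *m u1) (L *m u1).
(* The weights 1/8 turn r and xi into the last term of G.  The weight pD
   makes the errors cost h each; what is left, pA, exceeds 1/4, so that A
   costs less than eta times the square of x1. *)
pose pA := (9 + gam) / (4 * (3 + gam)).
pose pD := gam / (2 * (3 + gam)).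
have g3 : 0 < 3 + gam by rewrite addr_gt0.
have g9 : 0 < 9 + gam by rewrite addr_gt0.
have pA0 : 0 < pA by rewrite /pA divr_gt0 // mulr_gt0.
have pD0 : 0 < pD by rewrite /pD divr_gt0 // mulr_gt0.
have p80 : 0 < 8^-1 :> R by rewrite invr_gt0.
have psum : pA + 8^-1 + 8^-1 + pD = 1.
  by rewrite /pA /pD; field; rewrite gt_eqF.
have HS := mdot_sqr_sum4 A (c *: (Lu *m (x1 - x0))) xi (c *: (L *m (e0 - e1)))
  pA0 p80 p80 pD0 psum.
have ES : A + c *: (Lu *m (x1 - x0)) + xi + c *: (L *m (e0 - e1)) =
    - (c *: (L *m u1)) by apply/eqP; rewrite -subr_eq0 opprK H2.
have Hr := Lu_sqr_le (x1 - x0); rewrite -/rho in Hr.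
have He : mdot (L *m (e0 - e1)) (L *m (e0 - e1)) <=
    lamn ^+ 2 * (2 * (mdot e0 e0 + mdot e1 e1)).
  apply: (le_trans (L_sqr_le _)); rewrite ler_wpM2l ?sqr_ge0 //.
  have := mdot_ge0 (e0 + e1); rewrite !mdot_linear (mdotC e1 e0); lra.
rewrite ES !mdot_linear mulrN opprK -/T in HS.
have HT : c ^+ 2 * T <= l ^+ 2 * X * (4 * (3 + gam) / (9 + gam)) +
    8 * (c ^+ 2 * lamun ^+ 2 + 4 * l ^+ 2) * rho +
    c ^+ 2 * lamn ^+ 2 * (2 * (mdot e0 e0 + mdot e1 e1)) * (2 * (3 + gam) / gam).
  rewrite expr2 -mulrA; apply: (le_trans HS); rewrite !invrK.
  have -> : (pA)^-1 = 4 * (3 + gam) / (9 + gam) by rewrite /pA invf_div.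
  have -> : (pD)^-1 = 2 * (3 + gam) / gam by rewrite /pD invf_div.
  set sA := 4 * (3 + gam) / (9 + gam); set sD := 2 * (3 + gam) / gam.
  have g3' := ltW g3; have g9' := ltW g9; have g' := ltW gam_gt0.
  have sA0 : 0 <= sA by rewrite /sA divr_ge0 // mulr_ge0.
  have sD0 : 0 <= sD by rewrite /sD divr_ge0 // mulr_ge0.
  have c20 : 0 <= c ^+ 2 by rewrite sqr_ge0.
  have F1 := ler_wpM2r sA0 H4.
  have F2 := ler_wpM2l c20 Hr.
  have F3 := ler_wpM2r sD0 (ler_wpM2l c20 He).
  move: F1 F2 F3 H5; lra.
have k0 : 0 <= (8 * c * beta * lam2)^-1 by rewrite invr_ge0 !mulr_ge0 // ltW.
have Hgap := L_gap u1; rewrite -/T in Hgap.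
have c20 : 0 <= c ^+ 2 by rewrite sqr_ge0.
have := ler_wpM2l k0 (le_trans (ler_wpM2l c20 Hgap) HT).
have -> : (8 * c * beta * lam2)^-1 * (c ^+ 2 * (lam2 * mdot u1 (L *m u1))) =
    c / (8 * beta) * mdot u1 (L *m u1).
  by field; rewrite !gt_eqF.
move=> /le_trans; apply; rewrite le_eqVlt; apply/orP; left; apply/eqP.
rewrite /h /eta /gam; field.
by rewrite !gt_eqF ?addr_gt0 ?mulr_gt0.
Qed.

(** The term - v |x1|^2 is shared: a part eta |x1|^2 pays for A in [dual_bound],
    the rest absorbs - <xi, x1>.  The choice of eta is the reason for the lower
    bound assumed on beta, which says eta < v. *)
Lemma energy_decrease x0 x1 u0 u1 e0 e1 :
  ccdqm_relation x0 x1 u0 u1 e0 e1 ->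
  energy c L Lu x1 u1 e1 <=
    energy c L Lu x0 u0 e0 - G * mdot (x1 - x0) (x1 - x0)
    - zeta * mdot x1 x1 + h * mdot e0 e0
    + (h + 2 * c * beta * lamn) * mdot e1 e1.
Proof.
move=> rel; have Hd := dual_bound rel.
case: rel => [A [xi [H1 H2 H3 H4 H5]]].
have := energy_descent c_gt0 Ls Lus L_psd H1 H2.
have w0 : 0 < v - eta by rewrite subr_gt0.
have Hxi : - mdot xi x1 <= (v - eta) * mdot x1 x1 +
    l ^+ 2 / (v - eta) * mdot (x1 - x0) (x1 - x0).
  (* Young's inequality for xi and x1, with v - eta as the weight of x1 *)
  have H := mdot_ge0 ((2 * (v - eta)) *: x1 + xi).
  rewrite !mdot_linear (mdotC x1 xi) in H.
  have k0 : 0 <= (4 * (v - eta))^-1 by rewrite invr_ge0 mulr_ge0 // ltW.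
  have := mulr_ge0 k0 H; have := ler_wpM2l k0 H5.
  set rho := mdot (x1 - x0) (x1 - x0); set X := mdot x1 x1; set Y := mdot xi x1.
  have -> : (4 * (v - eta))^-1 * (4 * l ^+ 2 * rho) = l ^+ 2 / (v - eta) * rho.
    by field; rewrite gt_eqF.
  rewrite [Z in 0 <= Z -> _](_ : _ =
     (v - eta) * X + Y + (4 * (v - eta))^-1 * mdot xi xi); last first.
    by rewrite /X /Y; field; rewrite gt_eqF.
  lra.
have Hu : c * mdot u1 (L *m e1) <= c / (8 * beta) * mdot u1 (L *m u1) +
    2 * c * beta * lamn * mdot e1 e1.
  have k0 : 0 <= c / (8 * beta) by rewrite divr_ge0 ?mulr_ge0 // ltW.
  (* Young's inequality for the form of L, with 1 / (4 beta) as the weight of u1 *)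
  have := mulr_ge0 k0 (L_psd (u1 - (4 * beta) *: e1)).
  rewrite !(mulmxDr, mulmxN) -!scalemxAr !mdot_linear (mdot_sym e1 u1 Ls).
  rewrite [Z in 0 <= Z -> _](_ : _ =
     c / (8 * beta) * mdot u1 (L *m u1) - c * mdot u1 (L *m e1) +
     2 * c * beta * mdot e1 (L *m e1)); last by field; rewrite gt_eqF.
  have k1 : 0 <= 2 * c * beta by rewrite !mulr_ge0 // ltW.
  have := ler_wpM2l k1 (L_le e1); lra.
have Hr : c * lamu1 / 2 * mdot (x1 - x0) (x1 - x0) <=
    c / 2 * mdot (x1 - x0) (Lu *m (x1 - x0)).
  have k1 : 0 <= c / 2 by rewrite divr_ge0 // ltW.
  have := ler_wpM2l k1 (Lu_ge (x1 - x0)); lra.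
set rho := mdot (x1 - x0) (x1 - x0) in Hd Hxi Hr *.
set X := mdot x1 x1 in Hd H3 Hxi *.
have GE : G = c * lamu1 / 2 - l ^+ 2 / (v - eta) -
    (c ^+ 2 * lamun ^+ 2 + 4 * l ^+ 2) / (c * beta * lam2).
  rewrite /G /rate_gap; congr (_ - _ - _).
  have n1 : v - l ^+ 2 / (2 * c * beta * lam2) != 0 by rewrite gt_eqF.
  have n2 : 2 * c * beta * lam2 * v - l ^+ 2 != 0.
    apply: contra n1 => /eqP E; rewrite subr_eq0; apply/eqP.
    have -> : l ^+ 2 = 2 * c * beta * lam2 * v by lra.
    by field; rewrite !gt_eqF.
  by rewrite /eta; field; rewrite (mulrC v) n2 !gt_eqF.
have ZE : zeta = eta - eta * (3 + gam) / (9 + gam).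
  by rewrite /zeta; field; rewrite gt_eqF // addr_gt0.
move: Hd Hxi Hu Hr H3; rewrite GE ZE; lra.
Qed.

Lemma energy_ge (x u e : 'M[R]_(n, d)) :
  c / 2 * lamu1 * mdot x x <= energy c L Lu x u e.
Proof.
rewrite /energy -mulrA; apply: ler_wpM2l; first by rewrite divr_ge0 // ltW.
by rewrite -addrA (le_trans (Lu_ge x)) // lerDl addr_ge0.
Qed.

(** The energy after the step is bounded by the very terms that [energy_decrease]
    makes available, with a constant that does not depend on the step; hence a
    small multiple of it can be given away. *)
Lemma energy_upper : exists2 m, 0 < m &
  forall x0 x1 u0 u1 e0 e1, ccdqm_relation x0 x1 u0 u1 e0 e1 ->
    energy c L Lu x1 u1 e1 <= m * (mdot x1 x1 +
     mdot (x1 - x0) (x1 - x0) + mdot e0 e0 + mdot e1 e1).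
Proof.
pose b := (c ^+ 2 * lamun ^+ 2 + 4 * l ^+ 2) / (c * beta * lam2).
pose a := eta * (3 + gam) / (9 + gam).
have b0 : 0 <= b.
  rewrite /b; apply: divr_ge0; last by rewrite ltW // !mulr_gt0.
  by apply: addr_ge0; apply: mulr_ge0; rewrite ?sqr_ge0.
have g0 := ltW gam_gt0; have eta0 := ltW eta_gt0.
have a0 : 0 <= a by rewrite /a divr_ge0 ?addr_ge0 // mulr_ge0 // addr_ge0.
have lc : 0 < c * lamn by rewrite mulr_gt0.
have h0 : 0 < h by rewrite /h divr_gt0 // mulr_gt0 // addr_gt0.
have bet0 := ltW beta_gt0; have c0 := ltW c_gt0.
have uc : 0 <= c * lamun by rewrite mulr_ge0.
have ba0 : 0 <= beta * a by rewrite mulr_ge0.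
have bb0 : 0 <= beta * b by rewrite mulr_ge0.
have bh0 : 0 <= beta * h by rewrite mulr_ge0 // ltW.
exists (c * lamun + c * lamn + 4 * (beta * a + beta * b + beta * h)); first lra.
move=> x0 x1 u0 u1 e0 e1 /dual_bound; rewrite -/a -/b => Hd.
have X0 := mdot_ge0 x1; have r0 := mdot_ge0 (x1 - x0).
have E0 := mdot_ge0 e0; have E1 := mdot_ge0 e1.
rewrite /energy.
have k0 : 0 <= 4 * beta by rewrite mulr_ge0.
have := ler_wpM2l k0 Hd.
have -> : 4 * beta * (c / (8 * beta) * mdot u1 (L *m u1)) =
   c / 2 * mdot u1 (L *m u1) by field; rewrite gt_eqF.
have := ler_wpM2l c0 (Lu_le x1); have := ler_wpM2l c0 (L_le e1).
move: X0 r0 E0 E1.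
set X := mdot x1 x1; set r := mdot (x1 - x0) (x1 - x0).
set p := mdot e0 e0; set q := mdot e1 e1 => X0 r0 E0 E1 h1 h2 h3.
have [q1 q2 q3 q4] : [/\ 0 <= c * lamun * X, 0 <= c * lamun * r, 0 <= c * lamun * p
   & 0 <= c * lamun * q] by split; exact: mulr_ge0.
have [q5 q6 q7 q8] : [/\ 0 <= c * lamn * X, 0 <= c * lamn * r, 0 <= c * lamn * p
   & 0 <= c * lamn * q] by split; apply: mulr_ge0 => //; exact: ltW.
have [s1 s2 s3 s4] : [/\ 0 <= beta * a * X, 0 <= beta * a * r, 0 <= beta * a * p
   & 0 <= beta * a * q] by split; exact: mulr_ge0.
have [s5 s6 s7 s8] : [/\ 0 <= beta * b * X, 0 <= beta * b * r, 0 <= beta * b * p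
   & 0 <= beta * b * q] by split; exact: mulr_ge0.
have [t1 t2 t3 t4] : [/\ 0 <= beta * h * X, 0 <= beta * h * r, 0 <= beta * h * p
   & 0 <= beta * h * q] by split; exact: mulr_ge0.
lra.
Qed.

(** N is the weight at which the errors are charged; it must exceed the charge
    b0 made directly on |e_k|^2 plus what |e_(k+1)|^2 passes on to |e_k|^2.
    With h and a1 the charges on e_k and e_(k+1), eliminating N leaves
    (h + a1) q^2 / (1 - q)^2 to be paid by |r|^2.  This is less than G by
    hypothesis, and th is a fraction of the margin. *)
Lemma energy_contraction (q : R) :
  0 <= q < 1 -> 0 < G ->
  q ^+ 2 / (1 - q) ^+ 2 <
    G / (3 * c * lamn + 2 * c * beta * lamn + c * lamn ^+ 2 / (beta * lam2)) ->
  exists th N b0 b1 g,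
  [/\ 0 < th, 0 < N, 0 <= b0, 0 <= b1 & 0 <= g] /\
   [/\ b0 + b1 * q <= N, b1 * (q ^+ 2 / (1 - q)) <= g &
    forall x0 x1 u0 u1 e0 e1, ccdqm_relation x0 x1 u0 u1 e0 e1 ->
      (1 + th) * (energy c L Lu x1 u1 e1 + N * mdot e1 e1) +
        g * mdot (x1 - x0) (x1 - x0) <=
      energy c L Lu x0 u0 e0 + b0 * mdot e0 e0 + b1 * mdot e1 e1].
Proof.
move=> /andP[q0 q1] G0 Hq; have [m m0 Wm] := energy_upper.
have K0 : 0 < 3 * c * lamn + 2 * c * beta * lamn + c * lamn ^+ 2 / (beta * lam2).
  by rewrite !addr_gt0 ?divr_gt0 ?mulr_gt0 ?exprn_gt0.
have KE : 3 * c * lamn + 2 * c * beta * lamn + c * lamn ^+ 2 / (beta * lam2) =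
    h + (h + 2 * c * beta * lamn).
  by rewrite /h /gam; field; rewrite !gt_eqF.
rewrite {}KE in Hq K0; set a1 := h + 2 * c * beta * lamn in Hq K0.
have g0 := ltW gam_gt0; have eta0 := ltW eta_gt0.
have h0 : 0 < h by rewrite /h divr_gt0 // !mulr_gt0 // addr_gt0.
have a10 : 0 < a1 by rewrite /a1 addr_gt0 // !mulr_gt0.
have z0 : 0 < zeta by apply: divr_gt0; [rewrite mulr_gt0 | rewrite addr_gt0].
have p0 : 0 < 1 - q by rewrite subr_gt0.
set k := q ^+ 2 / (1 - q) ^+ 2 in Hq.
have k0 : 0 <= k by rewrite /k divr_ge0 // sqr_ge0.
(* tau is the margin left by the hypothesis; th and s are chosen as
   fractions of it. *)
pose tau := G - (h + a1) * k.
have tau0 : 0 < tau by rewrite /tau subr_gt0 mulrC -ltr_pdivlMr.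
have k10 : 0 < 2 * (k + 1) by lra.
pose s := tau / (2 * (k + 1)).
have s0 : 0 < s by rewrite /s divr_gt0.
pose Nb := (h + a1 + 2 * m + s) / (1 - q).
have Nb0 : 0 < Nb by rewrite /Nb divr_gt0 //; lra.
pose th := Num.min (Num.min 1 (zeta / m)) (Num.min (tau / (2 * m * (2 * k + 1))) (s / Nb)).
have k20 : 0 < 2 * k + 1 by lra.
have mk0 : 0 < 2 * m * (2 * k + 1) by rewrite !mulr_gt0.
have th0 : 0 < th.
  by rewrite /th !lt_min ltr01 (divr_gt0 z0 m0) (divr_gt0 tau0 mk0) (divr_gt0 s0 Nb0).
have th1 : th <= 1 by rewrite /th !ge_min lexx.
have th2 : th * m <= zeta by rewrite -ler_pdivlMr // /th !ge_min lexx orbT.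
have th3 : th * (2 * m * (2 * k + 1)) <= tau.
  by rewrite -ler_pdivlMr // /th !ge_min lexx !orbT.
have th4 : th * Nb <= s by rewrite -ler_pdivlMr // /th !ge_min lexx !orbT.
have sk : s * k <= tau / 2.
  rewrite /s; have -> : tau / (2 * (k + 1)) * k = tau / 2 * (k / (k + 1)).
    by field; rewrite gt_eqF //; lra.
  by rewrite ler_piMr ?divr_ge0 ?(ltW tau0) // ler_pdivrMr ?mul1r; lra.
pose c0 := h + th * m; pose c1 := a1 + th * m.
pose N' := (c0 + q * c1 + s) / (1 - q).
have thm0 : 0 <= th * m by rewrite mulr_ge0 // ltW.
have qc1 : 0 <= q * c1 by rewrite mulr_ge0 // /c1; lra.
have N'0 : 0 < N' by rewrite /N' divr_gt0 //; rewrite /c0; lra.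
have N'b : N' <= Nb.
  rewrite /N' /Nb ler_pM2r ?invr_gt0 //.
  have : q * c1 <= c1 by rewrite ler_piMl ?(ltW q1) // /c1; lra.
  have : th * m <= m by rewrite ler_piMl ?(ltW m0).
  rewrite /c0 /c1; lra.
have t10 : 0 < 1 + th by rewrite addr_gt0.
have bE : c1 + N' = (c0 + c1 + s) / (1 - q) by rewrite /N'; field; rewrite gt_eqF.
have NE : c0 + (c1 + N') * q = N' - s by rewrite /N'; field; rewrite gt_eqF.
exists th, (N' / (1 + th)), c0, (c1 + N'), (G - th * m).
have thmk : th * m * (2 * k + 1) <= tau / 2 by lra.
have thmt : th * m <= tau / 2.
  by apply: le_trans thmk; rewrite ler_peMr //; lra.
have hk : 0 <= (h + a1) * k by rewrite mulr_ge0 //; lra.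
have tauG : tau <= G by rewrite /tau; lra.
split; split.
- exact: th0.
- by rewrite divr_gt0.
- by rewrite /c0; lra.
- by rewrite /c1; lra.
- by lra.
- rewrite NE ler_pdivlMr //.
  have : th * N' <= s by apply: le_trans th4; rewrite ler_pM2l.
  have : 0 <= th * s by rewrite mulr_ge0 // ltW.
  lra.
- rewrite bE; have -> : (c0 + c1 + s) / (1 - q) * (q ^+ 2 / (1 - q)) = (c0 + c1 + s) * k.
    by rewrite /k; field; rewrite gt_eqF.
  have tE : (h + a1) * k = G - tau by rewrite /tau; ring.
  rewrite /c0 /c1; move: thmk sk tE; lra.
- move=> x0 x1 u0 u1 e0 e1 rel.
  have W1 := energy_decrease rel; have W2 := Wm _ _ _ _ _ _ rel.
  have := ler_wpM2l (ltW th0) W2; rewrite -/a1 in W1.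
  have -> : (1 + th) * (energy c L Lu x1 u1 e1 + N' / (1 + th) * mdot e1 e1) =
    energy c L Lu x1 u1 e1 + th * energy c L Lu x1 u1 e1 + N' * mdot e1 e1.
    by field; rewrite gt_eqF.
  have := ler_wpM2r (mdot_ge0 x1) th2.
  move: W1; rewrite /c0 /c1; lra.
Qed.

End Descent.

(** * Gradients and Hessians of strongly convex smooth functions *)

Lemma dotp_mdot (R : realType) d (x y : 'cV[R]_d) : dotp x y = mdot x y.
Proof. by rewrite mdotE; apply: eq_bigr => i _; rewrite big_ord1. Qed.

Lemma dotp_ge0 (R : realType) d (x : 'cV[R]_d) : 0 <= dotp x x.
Proof. by rewrite dotp_mdot mdot_ge0. Qed.

Lemma enorm_sqr (R : realType) d (x : 'cV[R]_d) : enorm x ^+ 2 = dotp x x.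
Proof. by rewrite sqr_sqrtr // dotp_ge0. Qed.

(** The directional derivative is linear in the direction. *)
Lemma derive_decomp (R : realType) d (W : normedModType R)
    (g : 'cV[R]_d -> W) x (u : 'cV[R]_d) :
  differentiable g x ->
  'D_u g x = \sum_b u b 0 *: 'D_(delta_mx b 0) g x.
Proof.
move=> gx; rewrite deriveE //.
have {1}-> : u = \sum_b u b 0 *: delta_mx b 0.
  rewrite {1}[u]matrix_sum_delta; apply: eq_bigr => b _; rewrite big_ord1 //.
rewrite linear_sum; apply: eq_bigr => b _; rewrite linearZ /= deriveE //.
Qed.

Section SmoothFunction.
Variables (R : realType) (d : nat) (f : 'cV[R]_d -> R) (v l : R).
Hypothesis f2 : twice_differentiable f.
Implicit Types x u w : 'cV[R]_d.

Lemma grad_coord_differentiable a x : differentiable (fun z => grad f z a 0) x.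
Proof.
have := @differentiable_comp _ _ _ _ (grad f) (fun N : 'cV[R]_d => N a 0 : R) x
  (f2.2 x) (differentiable_coord _ _ _).
exact.
Qed.

Lemma derive_grad a x u :
  'D_u (fun z => grad f z a 0) x = (hess f x *m u) a 0.
Proof.
rewrite derive_decomp; last exact: grad_coord_differentiable.
by rewrite mxE; apply: eq_bigr => b _; rewrite mxE mulrC.
Qed.

Lemma grad_quotient_cvg a x u :
  h^-1 * (grad f (h *: u + x) a 0 - grad f x a 0) @[h --> 0^'] -->
  (hess f x *m u) a 0.
Proof.
rewrite -derive_grad.
have := @diff_derivable _ _ _ (fun z => grad f z a 0) x u (grad_coord_differentiable a x).
exact.
Qed.

Lemma grad_quotient_dotp_cvg x u w :
  dotp (h^-1 *: (grad f (h *: u + x) - grad f x)) w @[h --> 0^'] -->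
  dotp (hess f x *m u) w.
Proof.
apply: cvg_big => [|a _]; first exact: add_continuous.
apply: cvgM; last exact: cvg_cst.
apply: cvg_trans (grad_quotient_cvg (a := a) (x := x) (u := u)).
by apply: near_eq_cvg; near=> h; rewrite !mxE.
Unshelve. all: by end_near. Qed.

Lemma grad_quotient_norm_cvg x u :
  dotp (h^-1 *: (grad f (h *: u + x) - grad f x))
    (h^-1 *: (grad f (h *: u + x) - grad f x)) @[h --> 0^'] -->
  dotp (hess f x *m u) (hess f x *m u).
Proof.
apply: cvg_big => [|a _]; first exact: add_continuous.
by apply: cvgM; apply: cvg_trans (grad_quotient_cvg (a := a) (x := x) (u := u));
  apply: near_eq_cvg; near=> h; rewrite !mxE.
Unshelve. all: by end_near. Qed.

(** Divide the defining inequality for the points x and x + h u by h^2 and let h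
    tend to 0. *)
Lemma hess_strongly_convex x u :
  strongly_convex v f -> v * dotp u u <= dotp (hess f x *m u) u.
Proof.
move=> [_ fv]; apply: cvgr_to_ge (@grad_quotient_dotp_cvg x u u) _.
near=> h; have h0 : h != 0 by near: h; exact: nbhs_dnbhs_neq.
have := fv x (h *: u + x); rewrite addrK enorm_sqr !dotp_mdot !mdot_linear => H.
have h2 : 0 < h ^- 2 by rewrite invr_gt0 exprn_even_gt0.
rewrite -(ler_pM2l h2) in H.
have e1 : h ^- 2 * (v * (h * (h * mdot u u))) = v * mdot u u by field.
rewrite e1 in H; apply: le_trans H _; rewrite le_eqVlt; apply/orP; left; apply/eqP.
by field.
Unshelve. all: by end_near. Qed.

Lemma lipschitz_grad_dotp x y :
  lipschitz_grad l f -> dotp (grad f y - grad f x) (grad f y - grad f x) <=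
   l ^+ 2 * dotp (y - x) (y - x).
Proof.
move=> fl; have := fl x y; rewrite -!enorm_sqr -exprMn => H.
by rewrite ler_sqr // nnegrE ?sqrtr_ge0 // (le_trans _ H) // sqrtr_ge0.
Qed.

(** The operator norm is bounded by l because the difference quotients of the
    gradient are. *)
Lemma hess_lipschitz x u :
  lipschitz_grad l f -> dotp (hess f x *m u) (hess f x *m u) <= l ^+ 2 * dotp u u.
Proof.
move=> fl; apply: cvgr_to_le (@grad_quotient_norm_cvg x u) _.
near=> h; have h0 : h != 0 by near: h; exact: nbhs_dnbhs_neq.
have := lipschitz_grad_dotp x (h *: u + x) fl.
rewrite addrK !dotp_mdot !mdotZl !mdotZr => H.
have h2 : 0 < h ^- 2 by rewrite invr_gt0 exprn_even_gt0.
rewrite -(ler_pM2l h2) in H.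
have e1 : h ^- 2 * (l ^+ 2 * (h * (h * mdot u u))) = l ^+ 2 * mdot u u by field.
rewrite e1 in H; apply: le_trans H; rewrite le_eqVlt; apply/orP; left; apply/eqP.
by field.
Unshelve. all: by end_near. Qed.

End SmoothFunction.

(** The one-sided difference quotients are nonnegative in the directions u and
    - u, and the derivative is odd in the direction. *)
Lemma minimizer_derive0 (R : realType) d (F : 'cV[R]_d -> R) xs u :
  differentiable F xs -> (forall z, F xs <= F z) -> 'D_u F xs = 0.
Proof.
move=> Fd Fmin.
have ge0 w : 0 <= 'D_w F xs.
  have /cvg_dnbhs_at_right /cvgr_to_ge : (h^-1 *: ((F \o shift xs) (h *: w) - F xs))
    @[h --> 0^'] --> 'D_w F xs by exact: diff_derivable.
  apply; near=> h; rewrite /= mulr_ge0 ?subr_ge0 ?Fmin // invr_ge0.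
  by near: h; exact: nbhs_right_ge.
apply/eqP; rewrite eq_le ge0 andbT -oppr_ge0.
by have := ge0 (- u); rewrite !deriveE // linearN.
Unshelve. all: by end_near. Qed.

Lemma minimizer_grad_sum0 (R : realType) n d (f : 'I_n -> 'cV[R]_d -> R) xs :
  (forall i, twice_differentiable (f i)) ->
  (forall z, \sum_i f i xs <= \sum_i f i z) ->
  forall a, \sum_i grad (f i) xs a 0 = 0.
Proof.
move=> f2 fmin a; pose F := \sum_i f i.
have FE z : F z = \sum_i f i z by rewrite /F fct_sumE.
have Fd : differentiable F xs by apply: differentiable_sum => i; exact: (f2 i).1.
have F0 : 'D_(delta_mx a 0) F xs = 0.
  by apply: minimizer_derive0 => // z; rewrite !FE.
rewrite -[RHS]F0 derive_sum; last by move=> i; apply: diff_derivable; exact: (f2 i).1.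
by apply: eq_bigr => i _; rewrite mxE.
Qed.

(** * Trajectories in matrix form *)

(** Injectivity is stated on columns, where coercivity gives it. *)
Lemma unitmx_inj (R : realType) d (M : 'M[R]_d) :
  (forall u : 'cV[R]_d, M *m u = 0 -> u = 0) -> M \in unitmx.
Proof.
move=> Minj; rewrite -unitmx_tr -row_free_unit -kermx_eq0; apply/eqP/row_matrixP => i.
rewrite row0; apply: trmx_inj; rewrite trmx0; apply: Minj.
by rewrite -[X in X *m _]trmxK -trmx_mul -row_mul mulmx_ker row0 trmx0.
Qed.

Definition agents_mx (R : realType) n d (x : 'I_n -> 'cV[R]_d) : 'M[R]_(n, d) :=
  \matrix_(i, a) x i a 0.

Lemma mdot_agents (R : realType) n d (x y : 'I_n -> 'cV[R]_d) :
  mdot (agents_mx x) (agents_mx y) = \sum_i dotp (x i) (y i).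
Proof.
by rewrite mdotE; apply: eq_bigr => i _; apply: eq_bigr => a _; rewrite !mxE.
Qed.

Lemma agents_mxB (R : realType) n d (x y : 'I_n -> 'cV[R]_d) :
  agents_mx x - agents_mx y = agents_mx (fun i => x i - y i).
Proof. by apply/matrixP => i a; rewrite !mxE. Qed.

Lemma laplacian_agents (R : realType) n d (e : rel 'I_n) (y : 'I_n -> 'cV[R]_d) :
  laplacian R e *m agents_mx y = agents_mx (neighbor_diff e y).
Proof.
apply/matrixP => i a; rewrite laplacian_mul [RHS]mxE summxE; apply: eq_bigr => j _.
by rewrite !mxE.
Qed.

(** The ratio in the bound of |r|^2 by the energy plus |e|^2, the same for all
    realizations of the seeds. *)
Definition step_const (R : realType) (v l c lamn lamu1 : R) : R :=
  v ^- 2 * ((2 * l ^+ 2 + 6 * c ^+ 2 * lamn ^+ 2) * (2 / (c * lamu1)) +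
       12 * c * lamn + 6 * c ^+ 2 * lamn ^+ 2).

Lemma step_const_ge0 (R : realType) (v l c lamn lamu1 : R) :
  0 < c -> 0 <= lamn -> 0 < lamu1 -> 0 <= step_const v l c lamn lamu1.
Proof.
move=> c0 ln0 u0; rewrite /step_const mulr_ge0 ?invr_ge0 ?sqr_ge0 //.
have l2 := sqr_ge0 l; have cl2 := mulr_ge0 (sqr_ge0 c) (sqr_ge0 lamn).
have cl := mulr_ge0 (ltW c0) ln0.
have a0 : 0 <= 2 * l ^+ 2 + 6 * c ^+ 2 * lamn ^+ 2 by lra.
have cu : 0 <= 2 / (c * lamu1) by rewrite divr_ge0 // mulr_ge0 // ltW.
have := mulr_ge0 a0 cu; lra.
Qed.

Section Trajectory.
Variables (R : realType) (n d : nat) (e : rel 'I_n.+1).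
Variables (f : 'I_n.+1 -> 'cV[R]_d -> R) (v l c : R).
Variables (Cs : nat -> 'I_n.+1 -> 'cV[R]_d -> 'cV[R]_d).
Variables (x0 : 'I_n.+1 -> 'cV[R]_d) (xs : 'cV[R]_d) (Ss : 'M[R]_(n.+1, d)).
Hypotheses (f2 : forall i, twice_differentiable (f i)).
Hypotheses (fv : forall i, strongly_convex v (f i)).
Hypotheses (fl : forall i, lipschitz_grad l (f i)).
Hypothesis c_gt0 : 0 < c.
Let L := laplacian R e.
Let Lu := signless_laplacian R e.
Let grads (x : 'I_n.+1 -> 'cV[R]_d) := agents_mx (fun i => grad (f i) (x i)).
Hypothesis SsP : c *: (L *m Ss) = - grads (fun _ => xs).

Let st k := ccdqm e f c (fun _ => 0) Cs x0 k.
Let M i k := (2 * c * (degree e i)%:R)%:M + hess (f i) (st_y (st k) i).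

Definition x_dev k := agents_mx (st_x (st k)) - agents_mx (fun _ => xs).
Definition y_sum k := \sum_(j < k) agents_mx (st_y (st j.+1)).
(** The dual deviation is followed on the sum of the y_j rather than on phi, which
    is its image under c L; c^2 <u, L u> is the squared norm of phi - phi* for the
    pseudo-inverse of L. *)
Definition dual_dev k := y_sum k - Ss.
Definition comp_err k := agents_mx (st_y (st k)) - agents_mx (st_x (st k)).
Definition innovation k i := st_x (st k.+1) i - st_y (st k) i.

Let v_gt0 : 0 < v. Proof. by have [] := fv ord0. Qed.

Lemma newton_mx_coercive i k u : v * dotp u u <= dotp (M i k *m u) u.
Proof.
rewrite /M mulmxDl mul_scalar_mx !dotp_mdot mdotDl mdotZl -!dotp_mdot.
apply: (le_trans (hess_strongly_convex (f2 i) (st_y (st k) i) u (fv i))).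
by rewrite lerDr mulr_ge0 ?dotp_ge0 // !mulr_ge0 // ltW.
Qed.

(** The matrix inverted by the algorithm is coercive: the Hessian contributes v
    and the degree term is nonnegative. *)
Lemma newton_mx_unit i k : M i k \in unitmx.
Proof.
apply: unitmx_inj => u Mu; have := newton_mx_coercive i k u.
rewrite Mu [X in _ <= X]dotp_mdot mdotC mdotx0 pmulr_rle0 // => u0.
by apply: mdot_eq0; apply/eqP; rewrite -dotp_mdot eq_le u0 dotp_ge0.
Qed.

Let force k i := grad (f i) (st_x (st k) i) + c *: neighbor_diff e (st_y (st k)) i +
  st_phi (st k) i.

Lemma x_update k i :
  M i k *m (st_x (st k.+1) i - st_x (st k) i) = - force k i.
Proof.
rewrite /= addrC addKr mulmxN mulKVmx //; exact: newton_mx_unit.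
Qed.

(** With threshold 0 the message is always sent. *)
Lemma y_update k i :
  st_y (st k.+1) i = st_y (st k) i + Cs k i (innovation k i).
Proof. by rewrite /= sqrtr_ge0. Qed.

(** phi never leaves the range of L, since it starts at 0. *)
Lemma phi_sum k : agents_mx (st_phi (st k)) = c *: (L *m y_sum k).
Proof.
elim: k => [|k IHk].
  by rewrite /y_sum big_ord0 mulmx0 scaler0; apply/matrixP => i a; rewrite !mxE.
rewrite /y_sum big_ord_recr /= mulmxDr scalerDr -IHk laplacian_agents.
by apply/matrixP => i a; rewrite !mxE.
Qed.

Lemma laplacian_opt : L *m agents_mx (fun _ => xs) = 0.
Proof. by apply: laplacian_const_mul => i j a; rewrite !mxE. Qed.

Lemma force_dev k : agents_mx (force k) =
  (grads (st_x (st k)) - grads (fun _ => xs)) +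
  c *: (L *m (x_dev k + comp_err k + dual_dev k)).
Proof.
have -> : x_dev k + comp_err k + dual_dev k = agents_mx (st_y (st k)) -
    agents_mx (fun _ => xs) + (y_sum k - Ss).
  by congr (_ + _); rewrite /x_dev /comp_err addrC addrA subrK.
rewrite mulmxDr !mulmxBr laplacian_opt subr0 scalerDr scalerBr SsP opprK -phi_sum.
rewrite laplacian_agents; apply/matrixP => i a; rewrite !mxE; ring.
Qed.

Lemma x_dev_step k : x_dev k.+1 - x_dev k =
  agents_mx (fun i => st_x (st k.+1) i - st_x (st k) i).
Proof. by rewrite /x_dev opprB addrA subrK agents_mxB. Qed.

Let degree_signless (X : 'M[R]_(n.+1, d)) :
  c *: (L *m X) + c *: (Lu *m X) = agents_mx (fun i => (2 * c * (degree e i)%:R) *: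
    (\col_a X i a)).
Proof.
rewrite -scalerDr -mulmxDl laplacian_signless -scalemxAl scalerA.
by rewrite /degree_mx mul_diag_mx; apply/matrixP => i a; rewrite !mxE; ring.
Qed.

(** Substitute phi_k = c L s_k in the Newton step, and use L + Lu = 2 D to replace
    the degrees. *)
Lemma trajectory_relation k :
  ccdqm_relation L Lu c v l (x_dev k) (x_dev k.+1) (dual_dev k) (dual_dev k.+1)
    (comp_err k) (comp_err k.+1).
Proof.
pose r i := st_x (st k.+1) i - st_x (st k) i.
pose Hr i := hess (f i) (st_y (st k) i) *m r i.
have newton : agents_mx (force k) + agents_mx Hr +
    (c *: (L *m agents_mx r) + c *: (Lu *m agents_mx r)) = 0.
  rewrite degree_signless; apply/matrixP => i a.
  have := x_update k i; rewrite mulmxDl mul_scalar_mx -/(r i) -/(Hr i).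
  move/(congr1 (fun X : 'cV[R]_d => X a 0)); rewrite !mxE => E.
  rewrite -[X in _ + _ + _ * X](_ : r i a 0 = _) ?mxE //; move: E; lra.
exists (grads (st_x (st k.+1)) - grads (fun _ => xs)).
exists (grads (st_x (st k)) - grads (st_x (st k.+1)) + agents_mx Hr).
split.
- have -> : dual_dev k.+1 - dual_dev k = agents_mx (st_y (st k.+1)).
    by rewrite /dual_dev /y_sum big_ord_recr opprB addrA subrK [LHS]addrC addKr.
  have -> : x_dev k.+1 + comp_err k.+1 = agents_mx (st_y (st k.+1)) -
      agents_mx (fun _ => xs) by rewrite /x_dev /comp_err addrC addrA subrK.
  by rewrite mulmxBr laplacian_opt subr0.
- have -> : dual_dev k.+1 = y_sum k + agents_mx (st_y (st k.+1)) - Ss.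
    by rewrite /dual_dev /y_sum big_ord_recr.
  rewrite x_dev_step -/r -[RHS]newton force_dev.
  have -> : comp_err k - comp_err k.+1 =
      agents_mx (st_y (st k)) - agents_mx (st_y (st k.+1)) + agents_mx r.
    by apply/matrixP => i a; rewrite !mxE; ring.
  have -> : x_dev k + comp_err k + dual_dev k = agents_mx (st_y (st k)) -
    agents_mx (fun _ => xs) + (y_sum k - Ss).
    by congr (_ + _); rewrite /x_dev /comp_err addrC addrA subrK.
  rewrite !(mulmxDr, mulmxN) laplacian_opt.
  by apply/matrixP => i a; rewrite !mxE; ring.
- rewrite /x_dev /grads !agents_mxB !mdot_agents mulr_sumr.
  apply: ler_sum => i _; have [_ ] := fv i => /(_ xs (st_x (st k.+1) i)).
  by rewrite enorm_sqr.
- rewrite /x_dev /grads !agents_mxB !mdot_agents mulr_sumr.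
  apply: ler_sum => i _; exact: lipschitz_grad_dotp.
- have split2 : forall X Y : 'M[R]_(n.+1, d), mdot (X + Y) (X + Y) <=
      2 * mdot X X + 2 * mdot Y Y.
    move=> X Y; have := mdot_ge0 (X - Y); rewrite !mdot_linear (mdotC Y X); lra.
  apply: (le_trans (split2 _ _)); rewrite x_dev_step -/r agents_mxB !mdot_agents.
  rewrite !mulr_sumr -big_split /=; apply: ler_sum => i _.
  have := hess_lipschitz (f2 i) (st_y (st k) i) (r i) (fl i); rewrite -/(Hr i).
  have := lipschitz_grad_dotp (st_x (st k.+1) i) (st_x (st k) i) (fl i).
  rewrite (_ : dotp (st_x (st k) i - st_x (st k.+1) i) _ = dotp (r i) (r i)); last first.
    by rewrite -opprB !dotp_mdot mdotNl mdotNr opprK.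
  lra.
Qed.

Lemma comp_err_step k : mdot (comp_err k.+1) (comp_err k.+1) =
  \sum_i enorm (innovation k i - Cs k i (innovation k i)) ^+ 2.
Proof.
rewrite /comp_err agents_mxB mdot_agents; apply: eq_bigr => i _.
rewrite enorm_sqr y_update /innovation -[in RHS]opprB !dotp_mdot.
have E (A B D : 'cV[R]_d) : B + A - D = A - (D - B) by rewrite opprB addrCA addrA.
by rewrite mdotNl mdotNr opprK E.
Qed.

(** The vector handed to the compressor is r - e_k. *)
Lemma innovation_dev k : \sum_i enorm (innovation k i) ^+ 2 =
  mdot (x_dev k.+1 - x_dev k - comp_err k) (x_dev k.+1 - x_dev k - comp_err k).
Proof.
have -> : x_dev k.+1 - x_dev k - comp_err k = agents_mx (innovation k).
  rewrite x_dev_step /comp_err /innovation.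
  by apply/matrixP => i a; rewrite !mxE; ring.
by rewrite mdot_agents; apply: eq_bigr => i _; rewrite enorm_sqr.
Qed.

Lemma step_le_force k : v ^+ 2 * mdot (x_dev k.+1 - x_dev k) (x_dev k.+1 - x_dev k) <=
  mdot (agents_mx (force k)) (agents_mx (force k)).
Proof.
rewrite x_dev_step !mdot_agents mulr_sumr; apply: ler_sum => i _.
have := newton_mx_coercive i k (st_x (st k.+1) i - st_x (st k) i).
rewrite x_update !dotp_mdot; set r := st_x _ i - st_x _ i.
move: r (force k i) => r g; rewrite mdotNl => H.
have := mdot_ge0 (g + v *: r); rewrite !mdot_linear (mdotC r g) => Hg.
have := ler_wpM2l (ltW v_gt0) H; lra.
Qed.

(** By coercivity r is bounded by the force divided by v, and the force is a
    Lipschitz function of the deviations.  This is what keeps the means finite,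
    so that they can be subtracted. *)
Lemma step_le_energy (lamn lamu1 : R) k :
  0 < lamu1 -> 0 <= lamn ->
  (forall X : 'M[R]_(n.+1, d), 0 <= mdot X (L *m X)) ->
  (forall X : 'M[R]_(n.+1, d), mdot (L *m X) (L *m X) <= lamn ^+ 2 * mdot X X) ->
  (forall X : 'M[R]_(n.+1, d), mdot (L *m X) (L *m X) <= lamn * mdot X (L *m X)) ->
  (forall X : 'M[R]_(n.+1, d), lamu1 * mdot X X <= mdot X (Lu *m X)) ->
  mdot (x_dev k.+1 - x_dev k) (x_dev k.+1 - x_dev k) <=
    step_const v l c lamn lamu1 *
    (energy c L Lu (x_dev k) (dual_dev k) (comp_err k) +
     mdot (comp_err k) (comp_err k)).
Proof.
move=> u0 ln0 Lpsd Lsqr Lform Luge.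
have v2 : 0 < v ^+ 2 by rewrite exprn_gt0.
rewrite /step_const -(mulrA (v ^- 2)) ler_pdivlMl //; apply: (le_trans (step_le_force k)).
rewrite force_dev; set x := x_dev k; set y := comp_err k; set u := dual_dev k.
set g := grads _ - grads _.
have g2 : mdot g g <= l ^+ 2 * mdot x x.
  rewrite /g /x /x_dev /grads !agents_mxB !mdot_agents mulr_sumr.
  by apply: ler_sum => i _; exact: lipschitz_grad_dotp.
have split2 (X Y : 'M[R]_(n.+1, d)) : mdot (X + Y) (X + Y) <=
    2 * mdot X X + 2 * mdot Y Y.
  by have := mdot_ge0 (X - Y); rewrite !mdot_linear (mdotC Y X); lra.
have split3 (X Y Z : 'M[R]_(n.+1, d)) : mdot (X + Y + Z) (X + Y + Z) <=
    3 * mdot X X + 3 * mdot Y Y + 3 * mdot Z Z.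
  have := mdot_ge0 (X - Y); have := mdot_ge0 (X - Z); have := mdot_ge0 (Y - Z).
  by rewrite !mdot_linear (mdotC Y X) (mdotC Z X) (mdotC Z Y); lra.
apply: (le_trans (split2 _ _)); rewrite mdotZl mdotZr.
have -> : L *m (x + y + u) = L *m x + L *m y + L *m u by rewrite -!mulmxDr.
have c20 : 0 <= c ^+ 2 by rewrite sqr_ge0.
have H3 := ler_wpM2l c20 (split3 (L *m x) (L *m y) (L *m u)).
have Hx := ler_wpM2l c20 (Lsqr x); have Hy := ler_wpM2l c20 (Lsqr y).
have Hu := ler_wpM2l c20 (Lform u).
have cu0 : 0 < c * lamu1 by rewrite mulr_gt0.
have Wx : mdot x x <= 2 / (c * lamu1) * energy c L Lu x u y.
  have k0 : 0 <= lamu1^-1 by rewrite invr_ge0 ltW.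
  have H := ler_wpM2l k0 (Luge x); rewrite mulrA mulVf ?gt_eqF // mul1r in H.
  apply: (le_trans H); rewrite /energy.
  have -> : 2 / (c * lamu1) * (c / 2 * (mdot x (Lu *m x) + mdot u (L *m u) + mdot y (L *m y))) =
     lamu1^-1 * (mdot x (Lu *m x) + mdot u (L *m u) + mdot y (L *m y)).
    by field; rewrite !gt_eqF.
  by apply: ler_wpM2l => //; rewrite -addrA lerDl addr_ge0.
have Wux : 0 <= mdot x (Lu *m x).
  by apply: le_trans (Luge x); rewrite mulr_ge0 ?mdot_ge0 // ltW.
have cl0 : 0 <= c * lamn by rewrite mulr_ge0 // ltW.
have Wu : c ^+ 2 * (lamn * mdot u (L *m u)) <= 2 * c * lamn * energy c L Lu x u y.
  rewrite /energy.
  have -> : 2 * c * lamn * (c / 2 * (mdot x (Lu *m x) + mdot u (L *m u) + mdot y (L *m y))) =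
     c ^+ 2 * (lamn * (mdot x (Lu *m x) + mdot u (L *m u) + mdot y (L *m y))) by field.
  apply: ler_wpM2l => //; apply: ler_wpM2l => //.
  have := Lpsd y; lra.
set W := energy c L Lu x u y in Wx Wu *.
have W0 : 0 <= W by rewrite /W /energy mulr_ge0 ?divr_ge0 ?(ltW c_gt0) // !addr_ge0.
have y0 := mdot_ge0 y.
have a0 : 0 <= 2 * l ^+ 2 + 6 * c ^+ 2 * lamn ^+ 2.
  have := sqr_ge0 l; have := mulr_ge0 c20 (sqr_ge0 lamn); lra.
have Hxx := ler_wpM2l a0 Wx.
have b0 : 0 <= (2 * l ^+ 2 + 6 * c ^+ 2 * lamn ^+ 2) * (2 / (c * lamu1)) +
    12 * c * lamn by have := mulr_ge0 a0 (divr_ge0 (ler0n R 2) (ltW cu0)); lra.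
have b1 : 0 <= 6 * c ^+ 2 * lamn ^+ 2 by have := mulr_ge0 c20 (sqr_ge0 lamn); lra.
have P1 := mulr_ge0 b0 y0; have P2 := mulr_ge0 b1 W0.
move: Hxx Wu H3 Hx Hy Hu g2 P1 P2; lra.
Qed.

End Trajectory.

(** * Measurability of matrix-valued maps *)

Definition measurable_mx (R : realType) dT (T : measurableType dT) m n
    (M : T -> 'M[R]_(m, n)) :=
  forall i j, measurable_fun setT (fun w => M w i j).

Notation borel_vec R d := (g_sigma_algebraType (@open 'cV[R]_d)).

(** A countable base: each point of U is within 1/(k+1) of a rational point whose
    ball of that radius stays in U. *)
Lemma open_rat_balls (R : realType) d (U : set 'cV[R]_d) : open U ->
  U = \bigcup_(p in [set p : 'cV[rat]_d * nat |
    ball (map_mx ratr p.1 : 'cV[R]_d) (p.2.+1%:R^-1) `<=` U])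
    ball (map_mx ratr p.1 : 'cV[R]_d) (p.2.+1%:R^-1).
Proof.
move=> oU; apply/seteqP; split => [x Ux|x [p /= pU /pU]] //.
have /nbhs_ballP[/= r r0 xrU] := open_nbhs_nbhs (conj oU Ux).
have /ltr_add_invr[k] : 0 < r / 2 by rewrite divr_gt0.
rewrite add0r => kr; set s := k.+1%:R^-1 in kr.
have s0 : 0 < s by rewrite invr_gt0.
have q_ex i : exists q : rat, `|x i 0 - ratr q| < s.
  have /rat_in_itvoo[q] : x i 0 - s < x i 0 + s by lra.
  by rewrite in_itv /= => /andP[q1 q2]; exists q; rewrite distrC ltr_distl q1 q2.
have [q qP] := choice q_ex.
pose Q : 'cV[rat]_d := \col_i q i.
have xQ : ball (map_mx ratr Q : 'cV[R]_d) s x.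
  by split => // i j; rewrite ord1 !mxE /ball /= distrC; exact: qP.
exists (Q, k) => //= z; rewrite -/s => Qz; apply: xrU.
apply: (@le_ball _ _ _ (s + s)); first lra.
by apply: ball_triangle Qz; exact: ball_sym.
Qed.

(** A map with measurable coordinates is measurable for the sigma-algebra
    generated by the open sets, because a ball for the sup norm is a box and
    countably many of them suffice. *)
Lemma measurable_borel_vec (R : realType) dT (T : measurableType dT) d
    (X : T -> 'cV[R]_d) :
  measurable_mx X -> measurable_fun setT (X : T -> borel_vec R d).
Proof.
move=> mX; apply: (@measurability _ _ _ (borel_vec R d) _ _ (@open 'cV[R]_d)) => // _ [U oU <-].
rewrite setTI (open_rat_balls oU) preimage_bigcup bigcup_mkcond.
apply: countable_bigcupT_measurable; first exact: countableP.
move=> [q m]; case: ifPn => // _ /=.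
have -> : X @^-1` ball (map_mx ratr q : 'cV[R]_d) m.+1%:R^-1 =
    \bigcap_(i in [set: 'I_d]) [set w | `|ratr (q i 0) - X w i 0| < m.+1%:R^-1].
  apply/seteqP; split => w /=.
    by move=> [_ H] i _; have := H i 0; rewrite mxE.
  by move=> H; split => [|i j]; rewrite ?invr_gt0 // ord1 mxE; exact: H.
apply: fin_bigcap_measurable => // i _.
have mg : measurable_fun setT (fun w => `|ratr (q i 0) - X w i 0|).
  by apply: measurableT_comp => //; apply: measurable_funB => //; exact: mX.
have -> : [set w | `|ratr (q i 0) - X w i 0| < m.+1%:R^-1] =
    setT `&` (fun w => `|ratr (q i 0) - X w i 0|) @^-1` `]-oo, m.+1%:R^-1[%classic.
  by rewrite setTI; apply/seteqP; split => w /=; rewrite in_itv.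
by apply: mg => //; exact: measurable_itv.
Qed.

Lemma continuous_measurable_borel_vec (R : realType) d (g : 'cV[R]_d -> R) :
  continuous g -> measurable_fun setT (g : borel_vec R d -> R).
Proof.
move=> cg; apply: (measurability _ (RGenOpens.measurableE R)) => _ [_ [a [b ->]] <-].
rewrite setTI; apply: sub_sigma_algebra; move/continuousP : cg; apply.
exact: interval_open.
Qed.

(** The inverse is continuous away from 0, and the remaining set is one point. *)
Lemma measurable_inv (R : realType) : measurable_fun setT (@GRing.inv R).
Proof.
have -> : [set: R] = [set~ 0] `|` [set 0] by rewrite setUC setUv.
apply/measurable_funU => //; first exact: measurableC.
split; last exact: measurable_fun_set1.
apply: open_continuous_measurable_fun.
  by apply: closed_openC; exact: closed_eq.
by move=> x; rewrite inE /= => /eqP x0; exact: inv_continuous.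
Qed.

Section MeasurableMatrix.
Variables (R : realType) (dT : measure_display) (T : measurableType dT).

Lemma measurable_mx_cst m n (A : 'M[R]_(m, n)) : measurable_mx (fun _ : T => A).
Proof. by move=> i j; exact: measurable_cst. Qed.

Lemma measurable_mxD m n (A B : T -> 'M[R]_(m, n)) :
  measurable_mx A -> measurable_mx B -> measurable_mx (fun w => A w + B w).
Proof.
move=> mA mB i j; under eq_fun do rewrite mxE.
by apply: measurable_funD; [exact: mA|exact: mB].
Qed.

Lemma measurable_mxN m n (A : T -> 'M[R]_(m, n)) :
  measurable_mx A -> measurable_mx (fun w => - A w).
Proof.
by move=> mA i j; under eq_fun do rewrite mxE; apply: measurableT_comp => //; exact: mA.
Qed.

Lemma measurable_mxB m n (A B : T -> 'M[R]_(m, n)) :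
  measurable_mx A -> measurable_mx B -> measurable_mx (fun w => A w - B w).
Proof. by move=> mA mB; apply: measurable_mxD => //; exact: measurable_mxN. Qed.

Lemma measurable_mxZ m n (k : T -> R) (A : T -> 'M[R]_(m, n)) :
  measurable_fun setT k -> measurable_mx A -> measurable_mx (fun w => k w *: A w).
Proof.
move=> mk mA i j; under eq_fun do rewrite mxE.
by apply: measurable_funM => //; exact: mA.
Qed.

Lemma measurable_mxM m n p (A : T -> 'M[R]_(m, n)) (B : T -> 'M[R]_(n, p)) :
  measurable_mx A -> measurable_mx B -> measurable_mx (fun w => A w *m B w).
Proof.
move=> mA mB i j; under eq_fun do rewrite mxE.
by apply: measurable_sum => k; apply: measurable_funM; [exact: mA|exact: mB].
Qed.

Lemma measurable_mx_sum m n (I : Type) (s : seq I) (P : pred I)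
    (A : I -> T -> 'M[R]_(m, n)) :
  (forall i, measurable_mx (A i)) -> measurable_mx (fun w => \sum_(i <- s | P i) A i w).
Proof.
move=> mA i j; under eq_fun do rewrite summxE big_mkcond.
apply: measurable_sum => k; case: (P k); [exact: mA | exact: measurable_cst].
Qed.

Lemma measurable_mx_det n (A : T -> 'M[R]_n) :
  measurable_mx A -> measurable_fun setT (fun w => \det (A w)).
Proof.
move=> mA; apply: measurable_sum => s; apply: measurable_funM => //.
by apply: measurable_prod => i _; exact: mA.
Qed.

(** Cramer's formula. *)
Lemma measurable_mx_inv n (A : T -> 'M[R]_n) :
  measurable_mx A -> (forall w, A w \in unitmx) ->
  measurable_mx (fun w => invmx (A w)).
Proof.
move=> mA uA i j; under eq_fun do rewrite /invmx uA !mxE.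
apply: measurable_funM.
  by apply: (measurableT_comp (@measurable_inv R)); exact: measurable_mx_det.
apply: measurable_funM => //; apply: measurable_mx_det => a b.
by under eq_fun do rewrite !mxE; exact: mA.
Qed.

Lemma measurable_mdot m n (A B : T -> 'M[R]_(m, n)) :
  measurable_mx A -> measurable_mx B -> measurable_fun setT (fun w => mdot (A w) (B w)).
Proof.
move=> mA mB; under eq_fun do rewrite mdotE.
apply: measurable_sum => i; apply: measurable_sum => a.
by apply: measurable_funM; [exact: mA|exact: mB].
Qed.

Lemma measurable_agents_mx n d (x : 'I_n -> T -> 'cV[R]_d) :
  (forall i, measurable_mx (x i)) -> measurable_mx (fun w => agents_mx (fun i => x i w)).
Proof. by move=> mx i a; under eq_fun do rewrite mxE; exact: mx. Qed.

End MeasurableMatrix.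

(** * Measurability of the iterates *)

Section MeasurableOracle.
Variables (R : realType) (d : nat) (f : 'cV[R]_d -> R).
Hypothesis f2 : twice_differentiable f.
Variables (dT : measure_display) (T : measurableType dT) (X : T -> 'cV[R]_d).
Hypothesis mX : measurable_mx X.

Lemma measurable_continuous_comp (g : 'cV[R]_d -> R) :
  continuous g -> measurable_fun setT (fun w => g (X w)).
Proof.
move=> cg; apply: (measurableT_comp (continuous_measurable_borel_vec cg)).
exact: measurable_borel_vec.
Qed.

Lemma grad_coord_continuous a : continuous (fun z => grad f z a 0).
Proof. by move=> x; apply/differentiable_continuous/grad_coord_differentiable. Qed.

Lemma measurable_grad : measurable_mx (fun w => grad f (X w)).
Proof.
by move=> a j; rewrite ord1; exact: (measurable_continuous_comp (@grad_coord_continuous a)).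
Qed.

End MeasurableOracle.

Lemma harmonic_dnbhs (R : realType) : @harmonic R @ \oo --> (0 : R)^'.
Proof.
move=> A A0.
have H : \forall m \near \oo, @harmonic R m != 0 -> A (harmonic m) := @cvg_harmonic R _ A0.
change (\forall m \near \oo, A (@harmonic R m)); apply: filterS H => m; apply.
by apply: lt0r_neq0; exact: harmonic_gt0.
Qed.

(** The Hessian is a pointwise limit of difference quotients of the gradient,
    which is continuous. *)
Lemma measurable_hess (R : realType) d (f : 'cV[R]_d -> R) dT
    (T : measurableType dT) (X : T -> 'cV[R]_d) :
  twice_differentiable f -> measurable_mx X -> measurable_mx (fun w => hess f (X w)).
Proof.
move=> f2 mX a b.
(* difference quotients with the step 1 / (m + 1) *)
pose q (m : nat) (w : T) := (harmonic m)^-1 *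
  (grad f (harmonic m *: delta_mx b 0 + X w) a 0 - grad f (X w) a 0) : R.
apply: (@measurable_fun_cvg _ _ _ _ q) => [m|w _].
  apply: measurable_funM => //; apply: measurable_funB.
    apply: (measurable_grad f2) => //; apply: measurable_mxD => //.
  exact: (measurable_grad f2).
have E : (hess f (X w) *m (delta_mx b 0 : 'cV[R]_d)) a 0 = hess f (X w) a b by rewrite -colE mxE.
rewrite -E; exact: cvg_comp _ _ (@harmonic_dnbhs R)
  (@grad_quotient_cvg R d f f2 a (X w) (delta_mx b 0)).
Qed.

Section MeasurableIterates.
Variables (R : realType) (n d : nat) (e : rel 'I_n.+1).
Variables (f : 'I_n.+1 -> 'cV[R]_d -> R) (v c : R) (x0 : 'I_n.+1 -> 'cV[R]_d).
Variables (dX : measure_display) (Xi : measurableType dX) (C : 'cV[R]_d -> Xi -> 'cV[R]_d).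
Hypotheses (f2 : forall i, twice_differentiable (f i)).
Hypotheses (fv : forall i, strongly_convex v (f i)).
Hypotheses (c_gt0 : 0 < c) (CP : randomized_map C).
Variables (dT : measure_display) (T : measurableType dT).
Variable (seed : nat -> 'I_n.+1 -> T -> Xi).
Let st k w := ccdqm e f c (fun _ => 0) (fun l i z => C z (seed l i w)) x0 k.

Lemma measurable_compressor (Z : T -> 'cV[R]_d) (s : T -> Xi) :
  measurable_mx Z -> measurable_fun setT s -> measurable_mx (fun w => C (Z w) (s w)).
Proof.
move=> mZ ms a j; rewrite ord1.
have mp : measurable_fun setT (fun w => (Z w, s w) : borel_vec R d * Xi).
  by apply: measurable_fun_pair => //; exact: measurable_borel_vec.
exact: measurableT_comp (CP a) mp.
Qed.

Lemma measurable_neighbor_diff (y : 'I_n.+1 -> T -> 'cV[R]_d) i :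
  (forall i, measurable_mx (y i)) ->
  measurable_mx (fun w => neighbor_diff e (fun j => y j w) i).
Proof. by move=> my; apply: measurable_mx_sum => j; exact: measurable_mxB. Qed.

Lemma measurable_x_update k :
  (forall i, measurable_mx (fun w => st_x (st k w) i)) ->
  (forall i, measurable_mx (fun w => st_y (st k w) i)) ->
  (forall i, measurable_mx (fun w => st_phi (st k w) i)) ->
  forall i, measurable_mx (fun w => st_x (st k.+1 w) i).
Proof.
move=> mx my mp i; apply: measurable_mxB => //; apply: measurable_mxM.
  apply: measurable_mx_inv => [|w]; last exact: newton_mx_unit.
  by apply: measurable_mxD; [exact: measurable_mx_cst|exact: measurable_hess].
apply: measurable_mxD => //; apply: measurable_mxD; first exact: measurable_grad.
by apply: measurable_mxZ => //; exact: measurable_neighbor_diff.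
Qed.

(** The space T and its sigma-algebra are arbitrary: the lemma is used both for
    the sample space and for the sigma-algebra generated by the past seeds. *)
Lemma measurable_iterates k :
  (forall l i, (l < k)%N -> measurable_fun setT (seed l i)) ->
  [/\ forall i, measurable_mx (fun w => st_x (st k w) i),
      forall i, measurable_mx (fun w => st_y (st k w) i) &
      forall i, measurable_mx (fun w => st_phi (st k w) i)].
Proof.
elim: k => [|k IHk] ms.
  by split => i; exact: measurable_mx_cst.
have [mx my mp] := IHk (fun l i lk => ms l i (ltnW lk)).
have mx' := measurable_x_update mx my mp.
have my' i : measurable_mx (fun w => st_y (st k.+1 w) i).
  have -> : (fun w => st_y (st k.+1 w) i) = (fun w => st_y (st k w) i +
      C (st_x (st k.+1 w) i - st_y (st k w) i) (seed k i w)).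
    by apply/funext => w; rewrite /st y_update.
  apply: measurable_mxD => //; apply: measurable_compressor; last exact: ms.
  exact: measurable_mxB.
split=> // i; apply: measurable_mxD => //; apply: measurable_mxZ => //.
exact: measurable_neighbor_diff.
Qed.

End MeasurableIterates.

(** * Compression by a fresh seed contracts in mean *)

Section FreshCompression.
Local Open Scope ereal_scope.
Context (R : realType) (d : nat) (dO dX : measure_display).
Context (Omega : measurableType dO) (Xi : measurableType dX).
Context (P : probability Omega R) (Q : probability Xi R).
Context (delta : R) (C : 'cV[R]_d -> Xi -> 'cV[R]_d).
Hypothesis CP : contractive_compressor Q delta C.
Variables (Z : Omega -> 'cV[R]_d) (xi : {RV P >-> Xi}).
Hypothesis mZ : measurable_mx Z.
Hypothesis xi_law : forall A, measurable A -> distribution P xi A = Q A.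
Hypothesis xi_indep : forall A (B : set (borel_vec R d)),
  measurable A -> measurable B ->
  P (xi @^-1` A `&` (Z : Omega -> borel_vec R d) @^-1` B) =
  P (xi @^-1` A) * P ((Z : Omega -> borel_vec R d) @^-1` B).

Let Zb : Omega -> borel_vec R d := Z.
Let mZb : measurable_fun setT Zb := measurable_borel_vec mZ.
Let Zb_mixin := isMeasurableFun.Build _ _ _ _ _ mZb.
Let Zm : {mfun Omega >-> borel_vec R d} := HB.pack Zb Zb_mixin.

Let W : Omega -> borel_vec R d * Xi := fun w => (Z w, xi w).
Let mW : measurable_fun setT W.
Proof. by apply: measurable_fun_pair => //; exact: mZb. Qed.
Let W_mixin := isMeasurableFun.Build _ _ _ _ _ mW.
Let Wm : {mfun Omega >-> (borel_vec R d * Xi)%type} := HB.pack W W_mixin.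

(** By independence the law of the pair (Z, xi) is a product on rectangles, hence
    everywhere. *)
Lemma joint_law (X : set (borel_vec R d * Xi)) : measurable X ->
  (distribution P Zm \x Q) X = distribution P Wm X.
Proof.
apply: product_measure_unique => A B mA mB.
have E1 := xi_indep mB mA; have E2 : P (xi @^-1` B) = Q B := xi_law mB.
rewrite E2 muleC in E1; apply: etrans E1.
by congr (P _); apply/seteqP; split => w /= [].
Qed.

Lemma measurable_compression_error a :
  measurable_fun setT (fun p : borel_vec R d * Xi => ((p.1 - C p.1 p.2) a 0)%R).
Proof.
have [CR _ _] := CP.
under eq_fun do rewrite !mxE.
apply: measurable_funB; last exact: CR.
have mc : measurable_fun setT (fun z : borel_vec R d => z a (0 : 'I_1)%R : R).
  by apply: continuous_measurable_borel_vec; exact: coord_continuous.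
exact: (measurableT_comp mc measurable_fst).
Qed.

(** Once the joint law is a product, integrate first over the seed with the
    input frozen, where the compressor is contractive by definition. *)
Lemma fresh_compression :
  \int[P]_w ((enorm (Z w - C (Z w) (xi w)) ^+ 2)%R)%:E <=
  delta%:E * \int[P]_w ((enorm (Z w) ^+ 2)%R)%:E.
Proof.
have [CR /andP[delta0 _] CE] := CP.
pose h (p : borel_vec R d * Xi) := ((enorm (p.1 - C p.1 p.2) ^+ 2)%R)%:E.
have mh : measurable_fun setT h.
  apply/measurable_EFinP; under eq_fun do rewrite enorm_sqr.
  by apply: measurable_sum => a; apply: measurable_funM; exact: measurable_compression_error.
have h0 p : 0 <= h p by rewrite lee_fin sqr_ge0.
have mn : measurable_fun setT (fun z : borel_vec R d => ((enorm z ^+ 2)%R)%:E).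
  apply/measurable_EFinP; under eq_fun do rewrite enorm_sqr.
  apply: measurable_sum => a.
  have mc : measurable_fun setT (fun z : borel_vec R d => z a (0 : 'I_1)%R : R).
    by apply: continuous_measurable_borel_vec; exact: coord_continuous.
  exact: measurable_funM.
have -> : \int[P]_w ((enorm (Z w - C (Z w) (xi w)) ^+ 2)%R)%:E =
    \int[distribution P Wm]_p h p.
  by rewrite ge0_integral_distribution.
have -> : \int[P]_w ((enorm (Z w) ^+ 2)%R)%:E =
    \int[distribution P Zm]_z ((enorm (z : 'cV[R]_d) ^+ 2)%R)%:E.
  by rewrite ge0_integral_distribution // => z; rewrite lee_fin sqr_ge0.
rewrite (@eq_measure_integral _ _ _ _ (distribution P Zm \x Q)
  (distribution P Wm)); last first.
  by move=> X mX _; apply: esym; exact: joint_law.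
rewrite (fubini_tonelli1 h) //.
rewrite -ge0_integralZl //; last by move=> z _; rewrite lee_fin sqr_ge0.
apply: ge0_le_integral => //.
- by move=> z _; exact: integral_ge0.
- exact: measurable_fun_fubini_tonelli_F.
- exact: measurable_funeM.
- by move=> z _; have := CE z; rewrite unlock EFinM.
Qed.

End FreshCompression.

(** * Means of nonnegative random variables *)

Section NonnegMean.
Context (R : realType) (dO : measure_display) (Omega : measurableType dO).
Variable P : probability Omega R.
Implicit Types f g : Omega -> R.

Definition nonneg_rv f := measurable_fun setT f /\ forall w, 0 <= f w.

Definition mean f : \bar R := (\int[P]_w (f w)%:E)%E.

Lemma nonneg_rvD f g : nonneg_rv f -> nonneg_rv g -> nonneg_rv (fun w => f w + g w).
Proof. by move=> [mf f0] [mg g0]; split=> [|w]; [exact: measurable_funD|rewrite addr_ge0]. Qed.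

Lemma nonneg_rvZ k f : 0 <= k -> nonneg_rv f -> nonneg_rv (fun w => k * f w).
Proof. by move=> k0 [mf f0]; split=> [|w]; [exact: measurable_funM|rewrite mulr_ge0]. Qed.

Lemma mean_ge0 f : nonneg_rv f -> (0 <= mean f)%E.
Proof. by move=> [_ f0]; apply: integral_ge0 => w _; rewrite lee_fin. Qed.

Lemma le_mean f g : nonneg_rv f -> nonneg_rv g -> (forall w, f w <= g w) ->
  (mean f <= mean g)%E.
Proof.
move=> [mf f0] [mg g0] fg; apply: ge0_le_integral => //.
- by move=> w _; rewrite lee_fin.
- exact/measurable_EFinP.
- exact/measurable_EFinP.
- by move=> w _; rewrite lee_fin.
Qed.

Lemma meanD f g : nonneg_rv f -> nonneg_rv g ->
  mean (fun w => f w + g w) = (mean f + mean g)%E.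
Proof.
move=> [mf f0] [mg g0]; rewrite /mean -ge0_integralD //.
- by move=> w _; rewrite lee_fin.
- exact/measurable_EFinP.
- by move=> w _; rewrite lee_fin.
- exact/measurable_EFinP.
Qed.

Lemma meanZ k f : 0 <= k -> nonneg_rv f -> mean (fun w => k * f w) = (k%:E * mean f)%E.
Proof.
move=> k0 [mf f0]; rewrite /mean -ge0_integralZl_EFin //.
- by move=> w _; rewrite lee_fin.
- exact/measurable_EFinP.
Qed.

Lemma mean_sum n (f : 'I_n -> Omega -> R) : (forall i, nonneg_rv (f i)) ->
  mean (fun w => \sum_i f i w) = (\sum_i mean (f i))%E.
Proof.
move=> f0; rewrite /mean -ge0_integral_sum //.
- by apply: eq_integral => w _; rewrite sumEFin.
- by move=> i; apply/measurable_EFinP; have [] := f0 i.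
- by move=> i w _; rewrite lee_fin; have [] := f0 i.
Qed.

Lemma mean_cst k : mean (fun _ => k) = k%:E.
Proof. by rewrite -[RHS](expectation_cst P k) unlock. Qed.

(** Finite means can be handled as real numbers, and in particular cancelled. *)
Lemma mean_fin f B : nonneg_rv f -> (mean f <= B%:E)%E -> mean f \is a fin_num.
Proof.
by move=> /mean_ge0 f0 fB; rewrite ge0_fin_numE // (le_lt_trans fB) // ltry.
Qed.

(** Because |t| <= 1 + t^2. *)
Lemma square_integrable f B :
  measurable_fun setT f -> (mean (fun w => (f w ^+ 2)%R) <= B%:E)%E ->
  P.-integrable setT (fun w => (f w)%:E).
Proof.
move=> mf fB; apply/integrableP; split; first exact/measurable_EFinP.
have m2 : nonneg_rv (fun w => f w ^+ 2).
  by split=> [|w]; [exact: measurable_funX|rewrite sqr_ge0].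
have m1 : nonneg_rv (fun w => `|f w|) by split=> [|w]; [exact: measurableT_comp|].
have c1 : nonneg_rv (fun _ => 1) by split.
apply: (@le_lt_trans _ _ (mean (fun w => (1 + f w ^+ 2)%R))).
  apply: (le_mean m1); first exact: nonneg_rvD.
  move=> w; rewrite -[f w ^+ 2]real_normK ?num_real //.
  have := sqr_ge0 (`|f w| - 1); have := normr_ge0 (f w); rewrite !expr2; nra.
by rewrite meanD // mean_cst // (@le_lt_trans _ _ (1 + B)%:E) ?ltry // EFinD leeD2l.
Qed.

(** Integrate 2 m t <= t^2 + m^2 at the mean m. *)
Lemma sqr_mean_le f B :
  measurable_fun setT f -> (mean (fun w => (f w ^+ 2)%R) <= B%:E)%E ->
  ((fine 'E_P[f] ^+ 2)%:E <= mean (fun w => (f w ^+ 2)%R))%E.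
Proof.
move=> mf fB; have fi := square_integrable mf fB.
have m2 : nonneg_rv (fun w => f w ^+ 2).
  by split=> [|w]; [exact: measurable_funX|rewrite sqr_ge0].
have f2fin := mean_fin m2 fB.
have f2i : P.-integrable setT (fun w => (f w ^+ 2)%:E).
  apply/integrableP; split; first by apply/measurable_EFinP; case: m2.
  rewrite (eq_integral (fun w => (f w ^+ 2)%:E)); last first.
    by move=> w _; rewrite /= ger0_norm ?sqr_ge0.
  exact: le_lt_trans fB (ltry B).
set m := fine 'E_P[f].
have mE : (\int[P]_w (f w)%:E)%E = m%:E.
  by rewrite /m unlock fineK // integrable_fin_num.
have H : (\int[P]_w ((2 * m * f w)%R)%:E <= \int[P]_w ((f w ^+ 2 + m ^+ 2)%R)%:E)%E.
  apply: le_integral => //.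
  - by under eq_fun do rewrite EFinM; exact: integrableZl.
  - under eq_fun do rewrite EFinD.
    by apply: integrableD => //; exact: finite_measure_integrable_cst.
  - by move=> w _; rewrite lee_fin; have := sqr_ge0 (f w - m); rewrite !expr2; nra.
move: H; under eq_integral do rewrite EFinM.
rewrite integralZl // mE.
have -> : (\int[P]_w ((f w ^+ 2 + m ^+ 2)%R)%:E = mean (fun w => (f w ^+ 2)%R) + (m ^+ 2)%:E)%E.
  by rewrite -/(mean _) meanD // ?mean_cst ?sqr_ge0 //; split=> //; rewrite sqr_ge0.
rewrite -EFinM -(fineK f2fin) -EFinD !lee_fin expr2; nra.
Qed.

End NonnegMean.

(** * From one step in mean to a linear rate *)

Section MeanContraction.
Context (R : realType) (dO : measure_display) (Omega : measurableType dO).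
Variable P : probability Omega R.
Variables (W E D Z : nat -> Omega -> R) (delta q th N b0 b1 g K B : R).
Hypotheses (W0 : forall k, nonneg_rv (W k)) (E0 : forall k, nonneg_rv (E k)).
Hypotheses (D0 : forall k, nonneg_rv (D k)) (Z0 : forall k, nonneg_rv (Z k)).
Hypotheses (th_gt0 : 0 < th) (N_gt0 : 0 < N) (b0_ge0 : 0 <= b0) (b1_ge0 : 0 <= b1).
Hypotheses (g_ge0 : 0 <= g) (K_ge0 : 0 <= K) (delta_ge0 : 0 <= delta).
Hypothesis b0N : b0 + b1 * q <= N.
Hypothesis b1g : b1 * (q ^+ 2 / (1 - q)) <= g.
Hypothesis WE_step : forall k w,
  (1 + th) * (W k.+1 w + N * E k.+1 w) + g * D k w <=
    W k w + b0 * E k w + b1 * E k.+1 w.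
Hypothesis E_step : forall k, (mean P (E k.+1) <= delta%:E * mean P (Z k))%E.
Hypothesis Z_le : forall k w,
  delta * Z k w <= q * E k w + q ^+ 2 / (1 - q) * D k w.
Hypothesis D_le : forall k w, D k w <= K * (W k w + E k w).
Hypothesis init : forall w, W 0%N w + N * E 0%N w <= B.

Let S k w := W k w + N * E k w.
Let S0 k : nonneg_rv (S k).
Proof. by apply: nonneg_rvD => //; apply: nonneg_rvZ => //; exact: ltW. Qed.

(** Taking means in the energy inequality, the term b1 E_(k+1) is replaced by its
    bound in terms of E_k and D_k; the D_k term is then at most g D_k, which is
    finite and cancels with the one on the left. *)
Lemma mean_contraction k : (mean P (S k) <= (B * (1 + th)^-1 ^+ k)%:E)%E.
Proof.
have B0 : 0 <= B.
  have [_ S00] := S0 0%N; exact: le_trans (S00 point) (init point).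
have t0 : 0 < 1 + th by rewrite addr_gt0.
elim: k => [|k IHk].
  rewrite expr0 mulr1 -(mean_cst P B); exact: le_mean.
set Bk := B * _ in IHk.
have Sfin := mean_fin (S0 k) IHk.
have Dfin : mean P (D k) \is a fin_num.
  pose K' := K * (1 + N^-1).
  have K'0 : 0 <= K' by rewrite mulr_ge0 // addr_ge0 // invr_ge0 ltW.
  apply: (@mean_fin _ _ _ P _ (K' * Bk)) => //.
  apply: (@le_trans _ _ (mean P (fun w => (K' * S k w)%R))).
    apply: le_mean => //; first exact: nonneg_rvZ.
    move=> w; apply: le_trans (D_le k w) _; rewrite -mulrA ler_wpM2l //.
    have [[_ /(_ w) Wk] [_ /(_ w) Ek]] := (W0 k, E0 k).
    have NW : 0 <= N^-1 * W k w by rewrite mulr_ge0 // invr_ge0 ltW.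
    have NE : 0 <= N * E k w by rewrite mulr_ge0 // ltW.
    rewrite /S mulrDl mul1r mulrDr mulrA mulVf ?gt_eqF // mul1r; lra.
  by rewrite meanZ // (EFinM K' Bk); apply: lee_wpmul2l => //; rewrite lee_fin.
have mb1 : nonneg_rv (fun w => W k w + b0 * E k w).
  by apply: nonneg_rvD => //; exact: nonneg_rvZ.
have bd0 : 0 <= b1 * delta by rewrite mulr_ge0.
have step : (mean P (fun w => ((1 + th) * S k.+1 w + g * D k w)%R) <=
    mean P (fun w => (S k w + g * D k w)%R))%E.
  apply: (@le_trans _ _ (mean P (fun w => ((W k w + b0 * E k w) + b1 * E k.+1 w)%R))).
    apply: le_mean => //.
      by apply: nonneg_rvD; apply: nonneg_rvZ => //; exact: ltW.
      by apply: nonneg_rvD => //; exact: nonneg_rvZ.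
    by move=> w; exact: WE_step.
  rewrite meanD //; last exact: nonneg_rvZ.
  apply: (@le_trans _ _ (mean P (fun w => ((W k w + b0 * E k w) + (b1 * delta) * Z k w)%R))).
    rewrite [leRHS]meanD //; last exact: nonneg_rvZ.
    by rewrite leeD2l // !meanZ // (EFinM b1 delta) -muleA;
      apply: lee_wpmul2l => //; rewrite lee_fin.
  apply: le_mean.
  - by apply: nonneg_rvD => //; exact: nonneg_rvZ.
  - by apply: nonneg_rvD => //; exact: nonneg_rvZ.
  move=> w; have [_ /(_ w) Ek] := E0 k; have [_ /(_ w) Dk] := D0 k.
  have := ler_wpM2l b1_ge0 (Z_le k w).
  have := ler_wpM2r Ek b0N; have := ler_wpM2r Dk b1g; rewrite /S; lra.
have n1 : nonneg_rv (fun w => (1 + th) * S k.+1 w).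
  by apply: nonneg_rvZ => //; exact: ltW.
have n2 : nonneg_rv (fun w => g * D k w) by exact: nonneg_rvZ.
move: step; rewrite (meanD _ n1 n2) (meanD _ (S0 k) n2).
rewrite leeD2rE; last by rewrite meanZ // fin_numM.
rewrite meanZ //; last exact: ltW.
rewrite -lee_pdivlMl // => /le_trans; apply.
by rewrite exprS mulrCA (EFinM (1 + th)^-1);
  apply: lee_wpmul2l => //; rewrite lee_fin invr_ge0 ltW.
Qed.

End MeanContraction.

Lemma expectation_vec_dev (R : realType) (dO : measure_display)
    (Omega : measurableType dO) (P : probability Omega R) m
    (X : Omega -> 'cV[R]_m) (s : 'cV[R]_m) (B : R) :
  measurable_mx X -> (mean P (fun w => dotp (X w - s) (X w - s)) <= B%:E)%E ->
  integrable_vec P X /\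
  dotp (expectation_vec P X - s) (expectation_vec P X - s) <= B.
Proof.
move=> mX XB; pose D (a : 'I_m) w := X w a 0 - s a 0.
have mD a : measurable_fun setT (D a).
  by apply: measurable_funB => //; exact: mX.
have mD2 a : nonneg_rv (fun w => D a w ^+ 2).
  by split=> [|w]; [exact: measurable_funX|rewrite sqr_ge0].
have XE w : dotp (X w - s) (X w - s) = \sum_a D a w ^+ 2.
  by apply: eq_bigr => a _; rewrite !mxE expr2.
have XsumB : (\sum_a mean P (fun w => (D a w ^+ 2)%R) <= B%:E)%E.
  by rewrite -mean_sum //; under [X in mean P X]eq_fun do rewrite -XE.
have DB a : (mean P (fun w => (D a w ^+ 2)%R) <= B%:E)%E.
  apply: le_trans XsumB; rewrite (bigD1 a) //= leeDl // sume_ge0 // => i _.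
  exact: mean_ge0.
have Di a : P.-integrable setT (fun w => (D a w)%:E).
  exact: square_integrable (mD a) (DB a).
have ci (r : R) : P.-integrable setT (fun _ => r%:E).
  exact: finite_measure_integrable_cst.
have Xi a : P.-integrable setT (fun w => (X w a 0)%:E).
  have -> : (fun w => (X w a 0)%:E) = (fun w => (D a w)%:E + (s a 0)%:E)%E.
    by apply/funext => w; rewrite -EFinD subrK.
  by apply: integrableD.
split=> //.
have DE a : fine 'E_P[D a] = (expectation_vec P X - s) a 0.
  rewrite !mxE unlock.
  have -> : (\int[P]_w (D a w)%:E = \int[P]_w (X w a 0)%:E - (s a 0)%:E)%E.
    under eq_integral do rewrite EFinB.
    rewrite integralB //; congr (_ - _)%E.
    exact: mean_cst.
  by rewrite fineB // integrable_fin_num.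
rewrite -lee_fin; apply: le_trans XsumB.
rewrite /dotp -sumEFin; apply: lee_sum => a _; rewrite -expr2 -DE.
exact: sqr_mean_le (mD a) (DB a).
Qed.

Lemma stackB (R : realType) n d (x y : 'I_n -> 'cV[R]_d) :
  stack x - stack y = stack (fun i => x i - y i).
Proof. by rewrite /stack -mxcolB. Qed.

Lemma dotp_stack (R : realType) n d (x y : 'I_n -> 'cV[R]_d) :
  dotp (stack x) (stack y) = \sum_i dotp (x i) (y i).
Proof.
rewrite dotp_mdot /mdot /stack tr_mxcol mul_mxrow_mxcol linear_sum.
by apply: eq_bigr => i _; rewrite dotp_mdot.
Qed.

Lemma measurable_stack (R : realType) dT (T : measurableType dT) n d
    (x : 'I_n -> T -> 'cV[R]_d) :
  (forall i, measurable_mx (x i)) -> measurable_mx (fun w => stack (fun i => x i w)).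
Proof. by move=> mx r j; under eq_fun do rewrite mxE; exact: mx. Qed.

(** * The iterates as a random process *)

Section Process.
Context (R : realType) (n d : nat) (dO dX : measure_display).
Context (Omega : measurableType dO) (Xi : measurableType dX).
Context (P : probability Omega R) (Q : probability Xi R).
Variables (e : rel 'I_n.+1) (f : 'I_n.+1 -> 'cV[R]_d -> R) (v c delta : R).
Variables (x0 : 'I_n.+1 -> 'cV[R]_d) (xs : 'cV[R]_d) (Ss : 'M[R]_(n.+1, d)).
Variables (C : 'cV[R]_d -> Xi -> 'cV[R]_d) (seed : nat -> 'I_n.+1 -> {RV P >-> Xi}).
Hypotheses (f2 : forall i, twice_differentiable (f i)).
Hypotheses (fv : forall i, strongly_convex v (f i)) (c_gt0 : 0 < c).
Hypotheses (CP : contractive_compressor Q delta C) (freshP : fresh_seeds Q seed).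

Definition realized_compressor w k i z := C z (seed k i w).
Let Cs := realized_compressor.
Let CR : randomized_map C. Proof. by case: CP. Qed.

(** The input of the compressor is a function of earlier seeds only.  This is
    where independence of the fresh seed from the past enters. *)
Lemma innovation_past k i :
  measurable_fun setT ((fun w => innovation e f c (Cs w) x0 k i) :
    g_sigma_algebraType (past_events (fun l j => seed l j : Omega -> Xi) k) ->
    borel_vec R d).
Proof.
pose T := g_sigma_algebraType (past_events (fun l j => seed l j : Omega -> Xi) k).
have ms l j : (l < k)%N -> measurable_fun setT (seed l j : T -> Xi).
  move=> lk _ A mA; rewrite setTI; apply: sub_sigma_algebra.
  by exists l, j, A.
apply: measurable_borel_vec.
have [mx my mp] := @measurable_iterates R n d e f v c x0 _ Xi C f2 fv c_gt0 CR _ T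
  (fun l j => seed l j) k ms.
apply: measurable_mxB; last exact: my.
exact: (@measurable_x_update R n d e f v c x0 _ Xi C f2 fv c_gt0 _ T
  (fun l j => seed l j) k mx my mp i).
Qed.

Let iterates_measurable k :=
  @measurable_iterates R n d e f v c x0 _ Xi C f2 fv c_gt0 CR _ Omega
  (fun l j => seed l j) k (fun l j _ => measurable_funPT (seed l j)).

Lemma measurable_innovation k i :
  measurable_mx (fun w => innovation e f c (Cs w) x0 k i).
Proof.
have [mx _ _] := iterates_measurable k.+1; have [_ my _] := iterates_measurable k.
by apply: measurable_mxB; [exact: mx|exact: my].
Qed.

Lemma measurable_x_dev k : measurable_mx (fun w => x_dev e f c (Cs w) x0 xs k).
Proof.
have [mx _ _] := iterates_measurable k.
apply: measurable_mxB; last exact: measurable_mx_cst.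
exact: (measurable_agents_mx mx).
Qed.

Lemma measurable_comp_err k : measurable_mx (fun w => comp_err e f c (Cs w) x0 k).
Proof.
have [mx my _] := iterates_measurable k.
by apply: measurable_mxB; exact: measurable_agents_mx.
Qed.

Lemma measurable_dual_dev k : measurable_mx (fun w => dual_dev e f c (Cs w) x0 Ss k).
Proof.
apply: measurable_mxB; last exact: measurable_mx_cst.
apply: measurable_mx_sum => j; have [_ my _] := iterates_measurable j.+1.
exact: measurable_agents_mx.
Qed.

(** The squared norm is a sum over the agents, and each agent's seed is fresh. *)
Lemma comp_err_mean k :
  (mean P (fun w => mdot (comp_err e f c (Cs w) x0 k.+1) (comp_err e f c (Cs w) x0 k.+1)) <=
   delta%:E * mean P (fun w => (\sum_i enorm (innovation e f c (Cs w) x0 k i) ^+ 2)%R))%E.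
Proof.
have [_ /andP[delta0 _] _] := CP.
have mI i : measurable_mx (fun w => innovation e f c (Cs w) x0 k i)
  by exact: measurable_innovation.
have sq (X : Omega -> 'cV[R]_d) : measurable_mx X -> nonneg_rv (fun w => enorm (X w) ^+ 2).
  move=> mX; split=> [|w]; last exact: sqr_ge0.
  by under eq_fun do rewrite enorm_sqr dotp_mdot; exact: measurable_mdot.
under [X in (mean P X <= _)%E]eq_fun do rewrite comp_err_step.
rewrite !mean_sum; last 2 first.
- by move=> i; exact: sq.
- move=> i; apply: sq; apply: measurable_mxB => //.
  by apply: measurable_compressor.
rewrite ge0_sume_distrr; last by move=> i _; apply: mean_ge0; exact: sq.
apply: lee_sum => i _; have [law indep] := freshP.
apply: (fresh_compression CP) => // [A mA|A B mA mB]; first exact: law.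
apply: indep => //; rewrite -[X in <<s _ >> X]setTI.
by have := @innovation_past k i; apply.
Qed.

End Process.

(** * Linear convergence *)

(** A single vertex has signless Laplacian 0. *)
Lemma posdef_signless_order (R : realType) n (e : rel 'I_n.+1) :
  irreflexive e -> posdef (signless_laplacian R e) -> (0 < n)%N.
Proof.
case: n e => [|//] e irr [_ /(_ (const_mx 1))].
have -> : signless_laplacian R e = 0.
  apply/matrixP => i j; rewrite !mxE !ord1 irr addr0 /degree eq_card0 //.
  by move=> k; rewrite unfold_in /= /in_set asboolb ord1 irr.
rewrite mul0mx dotp_mdot mdotx0 ltxx => H.
have /H // : (const_mx 1 : 'cV[R]_1) != 0.
by apply/eqP => /matrixP/(_ 0 0)/eqP; rewrite !mxE oner_eq0.
Qed.

(** If l = 0 the gradient is constant, against strong convexity in dimension at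
    least 1. *)
Lemma lipschitz_constant_neq0 (R : realType) d (f : 'cV[R]_d -> R) v l :
  (0 < d)%N -> strongly_convex v f -> lipschitz_grad l f -> l != 0.
Proof.
move=> d0 [v0 fv] fl; apply/eqP => l0; pose u : 'cV[R]_d := const_mx 1.
have := lipschitz_grad_dotp 0 u fl; have := fv 0 u.
rewrite l0 expr0n /= mul0r subr0 enorm_sqr !dotp_mdot => H1 H2.
have g0 : grad f u - grad f 0 = 0.
  by apply: mdot_eq0; apply/eqP; rewrite eq_le H2 mdot_ge0.
move: H1; rewrite g0 mdotC mdotx0 pmulr_rle0 // => u0.
have /mdot_eq0/matrixP/(_ (Ordinal d0) 0)/eqP : mdot u u = 0.
  by apply/eqP; rewrite eq_le u0 mdot_ge0.
by rewrite !mxE oner_eq0.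
Qed.

(** The weights make q, rather than q^2, the factor in front of |s|^2; the
    difference of the two sides is a multiple of |(1 - q) s + q r|^2. *)
Lemma young_contraction (R : realType) m d (q : R) (r s : 'M[R]_(m, d)) :
  0 <= q < 1 ->
  q ^+ 2 * mdot (r - s) (r - s) <= q * mdot s s + q ^+ 2 / (1 - q) * mdot r r.
Proof.
move=> /andP[q0 q1]; have p0 : 0 < 1 - q by rewrite subr_gt0.
have H := mdot_ge0 ((1 - q) *: s + q *: r).
have k0 : 0 <= q / (1 - q) by rewrite divr_ge0 // ltW.
have := mulr_ge0 k0 H; rewrite !mdot_linear (mdotC s r).
set a := mdot r r; set b := mdot r s; set z := mdot s s.
rewrite [X in 0 <= X -> _](_ : _ = q * z + q ^+ 2 / (1 - q) * a -
   q ^+ 2 * (a - b + (- b - - z))); last by field; rewrite gt_eqF.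
by rewrite subr_ge0.
Qed.

Lemma linear_rateO (R : realType) (u : nat -> R) (A s : R) :
  0 <= s -> (forall k, `|u k| <= A * s ^+ k) -> u =O_\oo (fun k => s ^+ k).
Proof.
move=> s0 us; apply/eqO_exP; exists (`|A| + 1); first by rewrite ltr_wpDl.
near=> k; rewrite (le_trans (us k)) // [`|s ^+ k|]ger0_norm ?exprn_ge0 //.
by rewrite ler_wpM2r ?exprn_ge0 // (le_trans (ler_norm A)) // lerDl.
Unshelve. all: by end_near. Qed.

(* The agents are indexed by 'I_n.+1, so that there are n.+1 of them. *)
Theorem theorem1 (R : realType) (n d : nat)
    (f : 'I_n.+1 -> 'cV[R]_d -> R) (v_ l_ : 'I_n.+1 -> R) (xstar : 'cV[R]_d)
    (e : rel 'I_n.+1) (lam lamu : seq R)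
    (dO dX : measure_display)
    (Omega : measurableType dO) (Xi : measurableType dX)
    (P : probability Omega R) (Q : probability Xi R)
    (C : 'cV[R]_d -> Xi -> 'cV[R]_d)
    (seed : nat -> 'I_n.+1 -> {RV P >-> Xi})
    (x0 : 'I_n.+1 -> 'cV[R]_d) (c delta beta : R) :
  let v := \big[Num.min/v_ ord0]_(i < n.+1) v_ i in
  let l := \big[Num.max/l_ ord0]_(i < n.+1) l_ i in
  let lam2 := lam`_1 in
  let lamn := lam`_n in
  let lamu1 := lamu`_0 in
  let lamun := lamu`_n in
  let G := rate_gap c l v lam2 lamu1 lamun in
  let x k w :=
    ccdqm_iterate e f c (fun _ => 0) C (fun m i => seed m i) x0 k w in
  (forall i, twice_differentiable (f i)) ->
  (forall i, strongly_convex (v_ i) (f i)) ->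
  (forall i, lipschitz_grad (l_ i) (f i)) ->
  (forall z, \sum_(i < n.+1) f i xstar <= \sum_(i < n.+1) f i z) ->
  irreflexive e ->
  symmetric e ->
  (forall i j, connect e i j) ->
  ordered_eigenvalues (laplacian R e) lam ->
  ordered_eigenvalues (signless_laplacian R e) lamu ->
  posdef (signless_laplacian R e) ->
  contractive_compressor Q delta C ->
  fresh_seeds Q seed ->
  0 < c ->
  l ^+ 2 / (2 * c * lam2 * v) < beta ->
  0 < G beta ->
  delta / (1 - Num.sqrt delta) ^+ 2 <
    G beta / (3 * c * lamn + 2 * c * beta * lamn
              + c * lamn ^+ 2 / (beta * lam2)) ->
  (forall k, integrable_vec P (x k)) /\
  exists sigma : R, 0 < sigma < 1 /\
    (fun k : nat => enorm (expectation_vec P (x k) - stack (fun _ => xstar)))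
      =O_\oo (fun k : nat => sigma ^+ k).
Proof.
move=> v l lam2 lamn lamu1 lamun G x f2 fv_ fl_ fmin irr sym conn lamP lamuP
  Lupos CP fresh c0 betaP G0 deltaP.
(* In dimension 0 the constants l_ are arbitrary, but all norms vanish. *)
have [d0|d0] := posnP d.
  have sum0 : (\sum_(i < n.+1) d = 0)%N by rewrite big1.
  have noidx (a : 'I_(\sum_(i < n.+1) d)) : False.
    by case: a => m; rewrite sum0.
  split; first by move=> k a; case: (noidx a).
  exists 2^-1; split; first by rewrite invr_gt0 ltr0n invf_lt1 ?ltr0n ?ltr1n.
  apply: (@linear_rateO _ _ 0) => [|k]; first by rewrite invr_ge0.
  have z (y : 'cV[R]_(\sum_(i < n.+1) d)) : dotp y y = 0.
    by apply: big1 => a _; case: (noidx a).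
  by rewrite mul0r /enorm z sqrtr0 normr0.
have fv i : strongly_convex v (f i).
  have [vi0 H] := fv_ i; split.
    by apply: lt_bigmin => [|j _]; [have [] := fv_ ord0 | have [] := fv_ j].
  move=> y y'; apply: le_trans (H y y'); rewrite ler_wpM2r ?sqr_ge0 //.
  exact: bigmin_le.
have fl i : lipschitz_grad l (f i).
  move=> y y'; apply: le_trans (fl_ i y y') _; rewrite ler_wpM2r ?sqrtr_ge0 //.
  exact: le_bigmax.
have v0 : 0 < v by have [] := fv ord0.
have l0 := lipschitz_constant_neq0 d0 (fv ord0) (fl ord0).
have n0 := posdef_signless_order irr Lupos.
set L := laplacian R e in lamP; set Lu := signless_laplacian R e in lamuP Lupos.
have Ls : L^T = L := laplacian_tr R sym.
have Lus : Lu^T = Lu := signless_laplacian_tr R sym.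
have lam20 : 0 < lam2 := laplacian_spectral_gap sym conn lamP n0.
have lamn0 : 0 < lamn.
  by apply: lt_le_trans lam20 _; apply: (ordered_eigenvalues_le lamP); rewrite n0 ltnSn.
have lamu10 : 0 < lamu1 := posdef_eigenvalue_first Lus lamuP Lupos.
have lamun0 : 0 <= lamun.
  by apply: le_trans (ltW lamu10) _; apply: (ordered_eigenvalues_le lamuP); rewrite ltnSn.
have [delta0 delta1] : 0 <= delta /\ delta < 1 by have [_ /andP[]] := CP.
pose q := Num.sqrt delta.
have q01 : 0 <= q < 1 by rewrite sqrtr_ge0 -sqrtr1 ltr_sqrt.
have q2 : q ^+ 2 = delta by rewrite sqr_sqrtr.
have [Ss SsP] : exists Ss : 'M[R]_(n.+1, d),
    c *: (L *m Ss) = - agents_mx (fun i => grad (f i) xstar).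
  have [a|S SP] := @laplacian_range _ _ _ _ sym conn lamP d
      (- c^-1 *: agents_mx (fun i => grad (f i) xstar)) n0.
    under eq_bigr do rewrite mxE [X in _ * X]mxE.
    by rewrite -mulr_sumr minimizer_grad_sum0 // mulr0.
  by exists S; rewrite SP scalerA mulrN mulfV ?gt_eqF // scaleN1r.
have Lpsd (X : 'M[R]_(n.+1, d)) : 0 <= mdot X (L *m X) := laplacian_psd sym X.
have Lgap (X : 'M[R]_(n.+1, d)) := laplacian_gap sym lamP X.
have lam1_ge0 : 0 <= lam`_0 := laplacian_eigenvalue_ge0 sym lamP (ltn0Sn n).
have Lle (X : 'M[R]_(n.+1, d)) := le_eigenvalue_last Ls lamP X.
have Lsqr (X : 'M[R]_(n.+1, d)) := sqr_le_eigenvalue_last Ls lamP X lam1_ge0.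
have Lform (X : 'M[R]_(n.+1, d)) := laplacian_sqr_le_form sym lamP X.
have Luge (X : 'M[R]_(n.+1, d)) := eigenvalue_first_le Lus lamuP X.
have Lule (X : 'M[R]_(n.+1, d)) := le_eigenvalue_last Lus lamuP X.
have Lusqr (X : 'M[R]_(n.+1, d)) := sqr_le_eigenvalue_last Lus lamuP X (ltW lamu10).
have [th [N [b0 [b1 [g [[th0 N0 b00 b10 g0] [b0N b1g step]]]]]]] :=
  energy_contraction Ls Lus Lpsd Lgap Lle Lsqr Luge Lule Lusqr lam20 lamn0 lamun0
    c0 v0 l0 betaP q01 G0 (eq_ind_r (fun t => t / _ < _) deltaP q2).
pose Cs w : nat -> 'I_n.+1 -> 'cV[R]_d -> 'cV[R]_d := realized_compressor C seed w.
pose X k w := x_dev e f c (Cs w) x0 xstar k.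
pose U k w := dual_dev e f c (Cs w) x0 Ss k.
pose Y k w := comp_err e f c (Cs w) x0 k.
pose W k w := energy c L Lu (X k w) (U k w) (Y k w).
have mX k : measurable_mx (X k) := measurable_x_dev e x0 xstar seed f2 fv c0 CP k.
have mU k : measurable_mx (U k) := measurable_dual_dev e x0 Ss seed f2 fv c0 CP k.
have mY k : measurable_mx (Y k) := measurable_comp_err e x0 seed f2 fv c0 CP k.
have nn (A : Omega -> 'M[R]_(n.+1, d)) : measurable_mx A ->
    nonneg_rv (fun w => mdot (A w) (A w)).
  by move=> mA; split=> [|w]; [exact: measurable_mdot | exact: mdot_ge0].
have Wlow k w : c / 2 * lamu1 * mdot (X k w) (X k w) <= W k w.
  exact: (energy_ge Lpsd Luge c0).
have k20 : 0 < c / 2 * lamu1 by rewrite mulr_gt0 // divr_gt0.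
have W0 k : nonneg_rv (W k).
  split=> [|w]; last by apply: le_trans (Wlow k w); rewrite mulr_ge0 ?mdot_ge0 ?(ltW k20).
  apply: measurable_funM => //.
  have mq (A : Omega -> 'M[R]_(n.+1, d)) (M : 'M[R]_n.+1) : measurable_mx A ->
      measurable_fun setT (fun w => mdot (A w) (M *m A w)).
    by move=> mA; apply: measurable_mdot => //; apply: measurable_mxM => //;
      exact: measurable_mx_cst.
  by apply: measurable_funD; [apply: measurable_funD|]; exact: mq.
pose K := step_const v l c lamn lamu1.
have K0 : 0 <= K by apply: step_const_ge0 => //; exact: ltW.
pose E k w := mdot (Y k w) (Y k w).
pose D k w := mdot (X k.+1 w - X k w) (X k.+1 w - X k w).
pose Z k w := \sum_i enorm (innovation e f c (Cs w) x0 k i) ^+ 2.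
have ZE k w : Z k w = mdot (X k.+1 w - X k w - Y k w) (X k.+1 w - X k w - Y k w).
  exact: innovation_dev.
have mXX k : measurable_mx (fun w => X k.+1 w - X k w) by exact: measurable_mxB.
(* The initial state does not depend on the sample, so its energy is a number. *)
pose w0 : Omega := point.
have XYU0 w : [/\ X 0%N w = X 0%N w0, U 0%N w = U 0%N w0 & Y 0%N w = Y 0%N w0].
  by rewrite /U /dual_dev /y_sum !big_ord0.
pose B := W 0%N w0 + N * E 0%N w0.
have Z0 k : nonneg_rv (Z k).
  have -> : Z k = fun w => mdot (X k.+1 w - X k w - Y k w) (X k.+1 w - X k w - Y k w).
    by apply/funext => w; exact: ZE.
  by apply: nn; exact: measurable_mxB.
have relation k w : ccdqm_relation L Lu c v l (X k w) (X k.+1 w) (U k w) (U k.+1 w)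
    (Y k w) (Y k.+1 w) by exact: trajectory_relation.
have SB k := @mean_contraction R dO Omega P W E D Z delta q th N b0 b1 g K B
  W0 (fun k => nn _ (mY k)) (fun k => nn _ (mXX k)) Z0 th0 N0 b00 b10 g0 K0 delta0 b0N b1g
  (fun k w => step _ _ _ _ _ _ (relation k w))
  (fun k => comp_err_mean e x0 f2 fv c0 CP fresh k) _ _ _ k.
have {}SB k : (mean P (fun w => (W k w + N * E k w)%R) <= (B * (1 + th)^-1 ^+ k)%:E)%E.
  apply: SB => [m w|m w|w].
  - by rewrite ZE -q2 young_contraction.
  - by apply: (step_le_energy (Cs w) x0 f2 fv fl c0 SsP) => //; exact: ltW.
  - by rewrite /B /W /E; have [-> -> ->] := XYU0 w.
pose B' := B / (c / 2 * lamu1).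
have B0 : 0 <= B.
  have [_ /(_ w0) ?] := W0 0%N; have [_ /(_ w0) ?] := nn _ (mY 0%N).
  by rewrite /B addr_ge0 // mulr_ge0 // ltW.
have B'0 : 0 <= B' by rewrite /B' divr_ge0 // ltW.
pose rho := (1 + th)^-1.
have t10 : 0 < 1 + th by rewrite addr_gt0.
have rho0 : 0 < rho by rewrite /rho invr_gt0.
have rho1 : rho < 1 by rewrite /rho invf_lt1 // ltrDl.
have Xmean k : (mean P (fun w => mdot (X k w) (X k w)) <= (B' * rho ^+ k)%:E)%E.
  apply: (@le_trans _ _ (mean P (fun w => ((c / 2 * lamu1)^-1 * (W k w + N * E k w))%R))).
    apply: le_mean.
    - exact: nn.
    - apply: nonneg_rvZ; first by rewrite invr_ge0 ltW.
      by apply: nonneg_rvD => //; apply: nonneg_rvZ; [exact: ltW | exact: nn].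
    - move=> w; rewrite ler_pdivlMl //; apply: le_trans (Wlow k w) _.
      by rewrite lerDl mulr_ge0 ?mdot_ge0 // ltW.
  rewrite meanZ; last first.
  - by apply: nonneg_rvD => //; apply: nonneg_rvZ; [exact: ltW | exact: nn].
  - by rewrite invr_ge0 ltW.
  have -> : B' * rho ^+ k = (c / 2 * lamu1)^-1 * (B * rho ^+ k).
    by rewrite /B' mulrAC mulrC.
  rewrite (EFinM (c / 2 * lamu1)^-1); apply: lee_wpmul2l; last exact: SB.
  by rewrite lee_fin invr_ge0 ltW.
have dev k w : dotp (x k w - stack (fun _ => xstar)) (x k w - stack (fun _ => xstar)) =
    mdot (X k w) (X k w).
  by rewrite /x /ccdqm_iterate stackB dotp_stack /X /x_dev agents_mxB mdot_agents.
have mx k : measurable_mx (x k).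
  have [mst _ _] := @measurable_iterates R n d e f v c x0 _ Xi C f2 fv c0
    (let: And3 CR _ _ := CP in CR) _ Omega
    (fun l j => seed l j) k (fun l j _ => measurable_funPT (seed l j)).
  exact: (measurable_stack mst).
have final k : integrable_vec P (x k) /\
    dotp (expectation_vec P (x k) - stack (fun _ => xstar))
      (expectation_vec P (x k) - stack (fun _ => xstar)) <= B' * rho ^+ k.
  apply: expectation_vec_dev => //.
  by under [X in mean P X]eq_fun do rewrite dev.
split=> [k|]; first by have [] := final k.
exists (Num.sqrt rho); split.
  by rewrite sqrtr_gt0 rho0 -sqrtr1 ltr_sqrt.
apply: (@linear_rateO _ _ (Num.sqrt B')) => [|k]; first exact: sqrtr_ge0.
have [_ Hk] := final k.
have s0 : 0 <= Num.sqrt B' * Num.sqrt rho ^+ k by rewrite mulr_ge0 ?exprn_ge0 ?sqrtr_ge0.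
rewrite ger0_norm ?sqrtr_ge0 // -ler_sqr ?nnegrE ?sqrtr_ge0 // enorm_sqr.
by rewrite exprMn sqr_sqrtr // exprAC sqr_sqrtr // ltW.
Qed.
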